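(* Consider the linear regression model with unknown noise variance described in the context, and assume that the $X_{ij}$, $1\le i\le n$, $1\le j\le p$, are i.i.d. standard Gaussian. Fix $\beta\in(1/2,1)$ and let $k=p^{1-\beta}$. (1) Suppose $k\log(p)=o(n)$ and let $r_{np}=x_{n,p}\sqrt{k\log(p)/n}$ satisfy $\limsup(x_{n,p}-\varphi(\beta))<0$, where $$\varphi(\beta)=\begin{cases}\sqrt{2\beta-1},&1/2<\beta\le 3/4,\\ \sqrt2\,(1-\sqrt{1-\beta}),&3/4<\beta<1.\end{cases}$$ Then distinguishability is impossible: $\gamma^{un}_{n,p,k}(r_{np})\to 1$. (2) If $k\log(p)/n\to\infty$, then for any radius $r>0$ distinguishability is impossible: $\gamma^{un}_{n,p,k}(r)\to 1$.
   Context: All limits and $o$ symbols are taken as $n\to\infty$ and $p\to\infty$ jointly. Model: one observes $Z=(X,Y)$ with $X=(X_{ij})_{1\le i\le n,1\le j\le p}$, $Y=(Y_1,\dots,Y_n)$ and $Y_i=\sum_{j=1}^p\theta_jX_{ij}+\xi_i$, where $\theta\in\mathbb{R}^p$ and $\sigma>0$ are unknown, the $\xi_i$ are i.i.d. $\mathcal{N}(0,\sigma^2)$ and independent of $X$. $E_{\theta,\sigma}$ is the expectation under the law of $Z$ with coefficient vector $\theta$ and noise standard deviation $\sigma$. $\|\cdot\|$ is the Euclidean norm; $\mathbb{R}^p_k$ is the set of $\theta\in\mathbb{R}^p$ with at most $k$ nonzero coordinates; $\Theta_k(r)=\{\theta\in\mathbb{R}^p_k:\|\theta\|\ge r\}$.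 A test is a measurable function $\psi(Z)$ with values in $[0,1]$ (not depending on $\sigma$). Put $$\alpha^{un}(\psi)=\sup_{\sigma>0}E_{0,\sigma}(\psi),\qquad \beta^{un}(\psi,\Theta)=\sup_{\theta\in\Theta,\ \sigma>0}E_{\theta\sigma,\sigma}(1-\psi),$$ where $\theta\sigma$ is the vector $\theta$ multiplied by the scalar $\sigma$, and $$\gamma^{un}_{n,p,k}(r)=\inf_\psi\big(\alpha^{un}(\psi)+\beta^{un}(\psi,\Theta_k(r))\big),$$ the infimum being over all tests. *)

(* Defs.v *)
From HB Require Import structures.
From mathcomp Require Import all_boot all_order all_algebra.
From mathcomp Require Import all_classical all_reals all_analysis.
From mathcomp Require Import measurable_realfun.

Set Implicit Arguments.
Unset Strict Implicit.
Unset Printing Implicit Defensive.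

Import Order.TTheory GRing.Theory Num.Theory.
Import numFieldNormedType.Exports.

Local Open Scope classical_set_scope.
Local Open Scope ring_scope.

Section iid_sample.
Context {d : measure_display} {T : measurableType d} {R : realType}.
Variable P : probability T R.

Definition tcons (n : nat) (z : T * n.-tuple T) : n.+1.-tuple T :=
  [tuple of z.1 :: z.2].

Lemma measurable_tcons (n : nat) : measurable_fun [set: T * n.-tuple T] (@tcons n).
Proof. exact: (measurable_cons measurable_fst measurable_snd). Qed.

HB.instance Definition _ (n : nat) := isMeasurableFun.Build _ _ _ _
  (@tcons n) (@measurable_tcons n).

(* The law P^{(x) n} of n independent draws from P. *)
Fixpoint iid (n : nat) : probability (n.-tuple T) R :=
  if n is m.+1 then distribution (P \x iid m)%E (@tcons m)
  else \d_([tuple]).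

(* [iid n] is the product measure: it factorizes on rectangles. *)
Lemma iid_rectangle (n : nat) (A : 'I_n -> set T) :
  (forall i, measurable (A i)) ->
  iid n [set t | forall i, A i (tnth t i)] = (\prod_(i < n) P (A i))%E.
Proof.
elim: n A => [|n IHn] A mA /=.
  by rewrite big_ord0 diracE mem_set //= => -[].
set B := [set t : n.-tuple T | forall i, A (lift ord0 i) (tnth t i)].
have mB : measurable B.
  have -> : B = \bigcap_(i in [set: 'I_n])
      ((@tnth n T ^~ i) @^-1` A (lift ord0 i)).
    by apply/seteqP; split => [t At i _ | t At i]; exact: At.
  apply: (@fin_bigcap_measurable _ (n.-tuple T)) => [|i _].
    exact: finite_finset.
  by rewrite -[_ @^-1` _]setTI; exact: measurable_tnth.
rewrite big_ord_recl /distribution /pushforward /= -(IHn _ (fun i => mA (lift ord0 i))).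
rewrite -product_measure1E //; congr (_ _).
apply/seteqP; split => [[x t] /= At|[x t] /= [Ax At] i].
  split=> [|i]; first by have := At ord0; rewrite tnth0.
  by have := At (lift ord0 i); rewrite tnthS.
by case: (unliftP ord0 i) => [j|] ->; rewrite ?tnthS ?tnth0.
Qed.

End iid_sample.

Section regression.
Variable R : realType.

(* [normal_prob m s] (s is the standard deviation) lives on [measurableTypeR R],
   whose sigma-algebra is that of R but whose display differs; it is carried
   over to R itself by the identity. *)
Definition idTR : measurableTypeR R -> R := idfun.

Lemma measurable_idTR : measurable_fun [set: measurableTypeR R] idTR.
Proof. exact: measurable_id. Qed.

HB.instance Definition _ := isMeasurableFun.Build _ _ _ _ idTR measurable_idTR.

Definition normal_law (m s : R) : probability R R :=
  distribution (normal_prob m s) idTR.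

Lemma normal_lawE (m s : R) (A : set R) : normal_law m s A = normal_prob m s A.
Proof. by []. Qed.

(* The i-th row of the design X is [tnth X i], so X_ij = tnth (tnth X i) j. *)
Definition design (n p : nat) := (n.-tuple (p.-tuple R))%type.
Definition data (n p : nat) := (design n p * n.-tuple R)%type.

(* (X, xi) |-> (X, Y), with Y_i = \sum_j theta_j X_ij + xi_i. *)
Definition observe (n p : nat) (theta : 'rV[R]_p)
    (z : design n p * n.-tuple R) : data n p :=
  (z.1, [tuple \sum_(j < p) theta 0 j * tnth (tnth z.1 i) j + tnth z.2 i | i < n]).

Lemma measurable_observe (n p : nat) (theta : 'rV[R]_p) :
  measurable_fun [set: design n p * n.-tuple R] (@observe n p theta).
Proof.
apply/measurable_fun_pairP; split; first exact: measurable_fst.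
apply/measurable_fun_tnthP => i /=.
rewrite (_ : _ \o _ = fun z : design n p * n.-tuple R =>
  \sum_(j < p) theta 0 j * tnth (tnth z.1 i) j + tnth z.2 i); last first.
  by apply/funext => z /=; rewrite tnth_mktuple.
apply: measurable_funD; last first.
  exact: (measurableT_comp (measurable_tnth i) measurable_snd).
apply: measurable_sum => j; apply: measurable_funM; first exact: measurable_cst.
apply: (measurableT_comp (measurable_tnth j)).
exact: (measurableT_comp (measurable_tnth i) measurable_fst).
Qed.

HB.instance Definition _ (n p : nat) (theta : 'rV[R]_p) :=
  isMeasurableFun.Build _ _ _ _ (@observe n p theta)
    (@measurable_observe n p theta).

(* The law of Z = (X, Y): X has i.i.d. N(0, 1) entries, the noise is i.i.d.
   N(0, sigma^2) and independent of X. *)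
Definition gaussian_law (n p : nat) (theta : 'rV[R]_p) (sigma : R) :
    probability (data n p) R :=
  distribution
    (iid (iid (normal_law 0 1) p) n \x iid (normal_law 0 sigma) n)%E
    (@observe n p theta).

(* The library norm on ['rV[R]_p] is the sup norm. *)
Definition euclidean_norm (p : nat) (theta : 'rV[R]_p) : R :=
  Num.sqrt (\sum_(j < p) theta 0 j ^+ 2).

Definition card_support (p : nat) (theta : 'rV[R]_p) : nat :=
  #|[pred j | theta 0 j != 0]|.

(* Theta_k(r); k may be any real number, as p^(1 - beta) need not be an
   integer. *)
Definition sparse_set (p : nat) (k r : R) : set 'rV[R]_p :=
  [set theta | (card_support theta)%:R <= k /\ r <= euclidean_norm theta].

Definition is_test (n p : nat) (psi : data n p -> R) : Prop :=
  measurable_fun [set: data n p] psi /\ forall z, 0 <= psi z <= 1.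

Definition alpha_un (n p : nat) (psi : data n p -> R) : \bar R :=
  ereal_sup [set ('E_(gaussian_law n (0 : 'rV_p) sigma) [psi])%E
            | sigma in [set s : R | 0 < s]].

Definition beta_un (n p : nat) (psi : data n p -> R) (Theta : set 'rV[R]_p) :
    \bar R :=
  ereal_sup [set ('E_(gaussian_law n (sigma *: theta) sigma)
                   [fun z => (1 - psi z)%R])%E
            | theta in Theta & sigma in [set s : R | 0 < s]].

Definition gamma_un (n p : nat) (k r : R) : \bar R :=
  ereal_inf [set (alpha_un psi + beta_un psi (sparse_set k r))%E
            | psi in @is_test n p].

Definition phi (beta : R) : R :=
  if beta <= 3 / 4 then Num.sqrt (2 * beta - 1)
  else Num.sqrt 2 * (1 - Num.sqrt (1 - beta)).

Definition sparsity (beta : R) (p : nat) : R := p%:R `^ (1 - beta).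

End regression.

(* Main.v *)
Require Import Defs.
From mathcomp Require Import all_boot all_order all_algebra.
From mathcomp Require Import all_classical all_reals all_analysis.
From mathcomp Require Import measurable_realfun ring lra.

Set Implicit Arguments.
Unset Strict Implicit.
Unset Printing Implicit Defensive.

Import Order.TTheory GRing.Theory Num.Theory.
Import numFieldNormedType.Exports.

Local Open Scope classical_set_scope.
Local Open Scope ring_scope.

(* Both parts use one Bayesian lower bound. The null has noise variance 1. Under
   the alternative theta is a * 1_S for a random support S of size K, the
   integer part of k, and the noise variance is 1 - a^2 K, so that Y has the same
   law as under the null: this is the place where the unknown variance is used.
   The likelihood ratio L_S is a product over rows, and per row
   E_0[L_S L_S'] = (1 - <theta, theta'>)^-1. For part (2), a^2 K stays fixed and
   the n-th power of this is p^(o(|S :&: S'|)), which is negligible because S and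
   S' are disjoint with probability tending to 1. For part (1),
   a = x sqrt(ln p / n), and L_S is first restricted to the event that all the
   <X_j, Y> with j in S are at most t sqrt(n ln p); bounding the indicators of
   the overlapping coordinates by exponentials (Chernoff) keeps the second moment
   computable and yields the sharp constant phi(beta). *)

(** * Gaussian integrals on the line *)

(** Alternatives are measured in units of the noise level, so the prior sits at radius a sqrt K /
    sqrt (1 - a^2 K); a^2 K = r^2 / (1 + r^2) reaches any r > 0. Two random supports meet with
    probability about K^2 / p = p^(1 - 2 beta), so a weight p^c per common coordinate is harmless
    when c < 2 beta - 1. Without truncation c = x^2, whence the branch sqrt (2 beta - 1). For beta >
    3/4 that second moment is inflated by rare samples in which some <X_j, Y> is far above its mean
    x sqrt (n ln p) under the alternative. With Chernoff exponent l in units of sqrt (ln p / n), c =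
    x^2 - 2 x l + l^2 / 2 + l t, whose minimum t^2 / 2 - (t - x)^2 is at l = 2 x - t. The truncation
    discards mass about p^(1 - beta - (t - x)^2 / 2). At t = sqrt 2 both requirements read (sqrt 2 -
    x)^2 > 2 (1 - beta), the second branch of [phi]; l >= 0 needs x >= 1 / sqrt 2 = phi (3/4), where
    the branches meet. *)

Section one_dim.
Variable R : realType.
Local Notation mu := (@lebesgue_measure R).

(** The Radon-Nikodym derivative with respect to Lebesgue measure equals [normal_pdf] almost
    everywhere, because both have the same integral over every measurable set. *)
Lemma ge0_integral_normal_law (m s : R) (f : R -> \bar R) :
  measurable_fun setT f -> (forall x, 0 <= f x)%E ->
  (\int[normal_law m s]_x f x = \int[mu]_x (f x * (normal_pdf m s x)%:E))%E.
Proof.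
move=> mf f0.
rewrite ge0_integral_distribution//.
have dom := @normal_prob_dominates R m s.
rewrite -(Radon_Nikodym_SigmaFinite.change_of_variables dom)//.
have mpdf : measurable_fun [set: measurableTypeR R]
    (fun x => (normal_pdf m s x)%:E).
  by apply/measurable_EFinP; exact: measurable_normal_pdf.
apply: ge0_ae_eq_integral => //.
- apply: emeasurable_funM => //.
  exact: measurable_int (Radon_Nikodym_SigmaFinite.f_integrable dom).
- exact: emeasurable_funM.
- by move=> x _; rewrite mule_ge0// Radon_Nikodym_SigmaFinite.f_ge0.
- by move=> x _; rewrite mule_ge0// lee_fin normal_pdf_ge0.
- apply: ae_eqe_mul2l; apply: integral_ae_eq => //.
  + exact: Radon_Nikodym_SigmaFinite.f_integrable.
  + by move=> E ES mE; exact/esym/(Radon_Nikodym_SigmaFinite.f_integral dom mE).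
Qed.

(** Lebesgue measure is determined by its values on half-open intervals, and translation preserves
    their length. *)
Lemma ge0_integral_lebesgue_shift (c : R) (f : R -> \bar R) :
  measurable_fun setT f -> (forall x, 0 <= f x)%E ->
  (\int[mu]_x f (c + x)%R = \int[mu]_x f x)%E.
Proof.
move=> mf f0.
have mc : measurable_fun [set: R] (fun x : R => c + x : measurableTypeR R).
  exact: measurable_funD.
transitivity (\int[pushforward mu (fun x : R => (c + x)%R : measurableTypeR R)]_x f x)%E.
  by rewrite ge0_integral_pushforward.
apply: eq_measure_integral => //= A mA _; apply/esym.
apply: (@lebesgue_measure_unique _
  (pushforward mu (fun x : R => c + x : measurableTypeR R))) => // X [[a b] _ <-].
rewrite /= /pushforward.
rewrite (_ : _ @^-1` _ = [set` `]a - c, b - c]]); last first.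
  apply/seteqP; split => x /=; rewrite !in_itv/= => /andP[? ?]; apply/andP; split; lra.
rewrite !lebesgue_measure_itv/= !lte_fin ltrD2r -!EFinB.
by case: ifP => // _; congr EFin; ring.
Qed.

(* Density of N(c, s^2) with respect to N(0, 1). *)
Definition normal_lr (c s y : R) : R :=
  s^-1 * expR (y ^+ 2 / 2 - (y - c) ^+ 2 / (2 * s ^+ 2)).

Lemma normal_lr_ge0 c s y : 0 <= s -> 0 <= normal_lr c s y.
Proof. by move=> s0; rewrite mulr_ge0 ?expR_ge0 ?invr_ge0. Qed.

Lemma normal_pdf_lr c s y : 0 < s ->
  normal_pdf c s y = normal_lr c s y * normal_pdf 0 1 y.
Proof.
move=> s0; rewrite !normal_pdfE ?gt_eqF//= /normal_lr /normal_peak /normal_fun.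
rewrite expr1n mul1r subr0 -mulrnAr sqrtrM ?sqr_ge0// sqrtr_sqr gtr0_norm// invfM.
rewrite -mulrA -[RHS]mulrA; congr (_ * _).
rewrite [RHS]mulrCA -expRD; congr (_ * expR _); field.
by rewrite gt_eqF.
Qed.

Lemma measurable_normal_lr s : measurable_fun setT
  (fun z : R * R => normal_lr z.1 s z.2).
Proof.
apply: measurable_funM; first exact: measurable_cst.
apply: measurableT_comp => //; apply: measurable_funB.
  apply: measurable_funM => //; exact: measurable_funX.
apply: measurable_funM => //; apply: measurable_funX; exact: measurable_funB.
Qed.

Lemma ge0_integral_normal_law_shift (c s : R) (f : R -> \bar R) : 0 < s ->
  measurable_fun setT f -> (forall x, 0 <= f x)%E ->
  (\int[normal_law 0 s]_x f (c + x)%R =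
   \int[normal_law 0 1]_y ((normal_lr c s y)%:E * f y))%E.
Proof.
move=> s0 mf f0.
rewrite ge0_integral_normal_law//; last first.
  by apply: measurableT_comp => //; exact: measurable_funD.
pose g y := (f y * (normal_pdf c s y)%:E)%E.
transitivity (\int[mu]_y g (c + y)%R)%E.
  apply: eq_integral => x _; congr (_ * _%:E)%E.
  by rewrite !normal_pdfE ?gt_eqF// /normal_fun [c + x]addrC addrK subr0.
rewrite (@ge0_integral_lebesgue_shift c g); last 2 first.
- apply: emeasurable_funM => //; apply/measurable_EFinP; exact: measurable_normal_pdf.
- by move=> x; rewrite mule_ge0// lee_fin normal_pdf_ge0.
rewrite ge0_integral_normal_law; last 2 first.
- apply: emeasurable_funM => //; apply/measurable_EFinP.
  exact: (measurableT_comp (measurable_normal_lr s) (measurable_pair1 c)).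
- by move=> x; rewrite mule_ge0// lee_fin normal_lr_ge0// ltW.
by apply: eq_integral => x _; rewrite /g normal_pdf_lr// EFinM muleA
  [in RHS](muleC _ (f x)).
Qed.

(** Completing the square: up to a constant, the integrand times the N(0, 1) density is the density
    of N(B / (1 + A), 1 / (1 + A)). *)
Lemma integral_normal_law_exp (A B C : R) : 0 < 1 + A ->
  (\int[normal_law 0 1]_x (expR (- A / 2 * x ^+ 2 + B * x + C))%:E =
   ((Num.sqrt (1 + A))^-1 * expR (B ^+ 2 / (2 * (1 + A)) + C))%:E)%E.
Proof.
move=> A0; rewrite ge0_integral_normal_law//; last first.
  apply/measurable_EFinP; apply: measurableT_comp => //.
  apply: measurable_funD => //; apply: measurable_funD; exact: measurable_funM.
pose s := (Num.sqrt (1 + A))^-1.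
have s0 : 0 < s by rewrite invr_gt0 sqrtr_gt0.
have s2 : s ^+ 2 = (1 + A)^-1 by rewrite exprVn sqr_sqrtr// ltW.
transitivity (\int[mu]_x ((s * expR (B ^+ 2 / (2 * (1 + A)) + C))%:E *
    (normal_pdf (B / (1 + A)) s x)%:E))%E.
  apply: eq_integral => x _.
  rewrite (normal_pdf_lr (B / (1 + A)) x s0) -!EFinM; congr EFin.
  rewrite [RHS]mulrA; congr (_ * _).
  rewrite /normal_lr [RHS]mulrACA mulfV ?gt_eqF// mul1r -expRD s2; congr expR.
  by field; rewrite gt_eqF.
rewrite ge0_integralZl//.
- by rewrite integral_normal_pdf mule1.
- by apply/measurable_EFinP; exact: measurable_normal_pdf.
- by move=> x _; rewrite lee_fin normal_pdf_ge0.
- by rewrite lee_fin mulr_ge0 ?expR_ge0// ltW.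
Qed.

End one_dim.

(** * Integrals against i.i.d. samples *)

Lemma emeasurable_fun_prod d (T : measurableType d) (R : realType)
    (I : Type) (s : seq I) (h : I -> T -> \bar R) :
  (forall i, measurable_fun setT (h i)) ->
  measurable_fun setT (fun x => \prod_(i <- s) h i x)%E.
Proof.
move=> mh; elim: s => [|i s IHs].
  under eq_fun do rewrite big_nil; exact: measurable_cst.
under eq_fun do rewrite big_cons; exact: emeasurable_funM.
Qed.

Section iid_integrals.
Context {d : measure_display} {T : measurableType d} {R : realType}.
Implicit Types P Q : probability T R.

Lemma ge0_integral_iidS P (n : nat) (f : n.+1.-tuple T -> \bar R) :
  measurable_fun setT f -> (forall t, 0 <= f t)%E ->
  (\int[iid P n.+1]_t f t = \int[P]_x \int[iid P n]_t f (tcons (x, t)))%E.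
Proof.
move=> mf f0; rewrite ge0_integral_distribution//.
rewrite fubini_tonelli1//; last by move=> x; exact: f0.
apply: measurableT_comp => //; exact: measurable_tcons.
Qed.

Lemma measurable_tcons2 (n : nat) (x : T) :
  measurable_fun [set: n.-tuple T] (fun t => tcons (x, t)).
Proof. exact: (measurableT_comp (@measurable_tcons _ T n) (measurable_pair1 x)). Qed.

Lemma integral_iid_prod P (n : nat) (g : 'I_n -> T -> \bar R) :
  (forall i, measurable_fun setT (g i)) -> (forall i x, 0 <= g i x)%E ->
  (\int[iid P n]_t \prod_(i < n) g i (tnth t i) =
   \prod_(i < n) \int[P]_x g i x)%E.
Proof.
elim: n g => [|n IHn] g mg g0.
  under eq_integral do rewrite big_ord0.
  by rewrite big_ord0 /= integral_dirac// diracT mul1e.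
rewrite ge0_integral_iidS; last 2 first.
- apply: emeasurable_fun_prod => i; exact: (measurableT_comp (mg i) (measurable_tnth i)).
- by move=> t; exact: prode_ge0.
transitivity (\int[P]_x (g ord0 x *
    \prod_(i < n) \int[P]_y g (lift ord0 i) y))%E; last first.
  rewrite big_ord_recl ge0_integralZr//.
  by apply: prode_ge0 => i _; exact: integral_ge0.
apply: eq_integral => x _; rewrite -IHn// -ge0_integralZl//.
- apply: eq_integral => t _; rewrite big_ord_recl/= tnth0; congr (_ * _)%E.
  by apply: eq_bigr => i _; rewrite tnthS.
- apply: emeasurable_fun_prod => i.
  exact: (measurableT_comp (mg _) (measurable_tnth i)).
- by move=> t _; exact: prode_ge0.
Qed.

(** The maps [tau] and densities [w] vary with [i] because, for a fixed design, each noise variable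
    is shifted by the mean of its own row. *)
Lemma ge0_integral_iid_density P Q (n : nat) (tau : 'I_n -> T -> T)
    (w : 'I_n -> T -> R) (F : n.-tuple T -> \bar R) :
  (forall i, measurable_fun setT (tau i)) ->
  (forall i, measurable_fun setT (w i)) -> (forall i x, 0 <= w i x) ->
  (forall i (f : T -> \bar R), measurable_fun setT f -> (forall x, 0 <= f x)%E ->
    (\int[P]_x f (tau i x) = \int[Q]_x ((w i x)%:E * f x))%E) ->
  measurable_fun setT F -> (forall t, 0 <= F t)%E ->
  (\int[iid P n]_t F [tuple tau i (tnth t i) | i < n] =
   \int[iid Q n]_t ((\prod_(i < n) w i (tnth t i))%:E * F t))%E.
Proof.
move=> mtau mw w0 PQ.
elim: n tau w F mtau mw w0 PQ => [|n IHn] tau w F mtau mw w0 PQ mF F0.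
  under [RHS]eq_integral do rewrite big_ord0 mul1e.
  by apply: eq_integral => t _; congr F; apply: eq_from_tnth => -[].
have mt : measurable_fun setT
    (fun t : n.+1.-tuple T => [tuple tau i (tnth t i) | i < n.+1]).
  apply/measurable_fun_tnthP => i; rewrite (_ : _ \o _ = tau i \o (@tnth n.+1 T ^~ i)).
    exact: (measurableT_comp (mtau i) (measurable_tnth i)).
  by apply/funext => t /=; rewrite tnth_mktuple.
have mwp k (v : 'I_k -> T -> R) : (forall i, measurable_fun setT (v i)) ->
    measurable_fun setT (fun t : k.-tuple T => (\prod_(i < k) v i (tnth t i))%:E).
  move=> mv; apply/measurable_EFinP; apply: measurable_prod => i _.
  exact: (measurableT_comp (mv i) (measurable_tnth i)).
rewrite ge0_integral_iidS//; last exact: measurableT_comp.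
rewrite ge0_integral_iidS//; last 2 first.
- by apply: emeasurable_funM => //; exact: mwp.
- by move=> t; rewrite mule_ge0// lee_fin prodr_ge0.
pose G x := (\int[iid Q n]_t
  ((\prod_(i < n) w (lift ord0 i) (tnth t i))%:E * F (tcons (x, t))))%E.
have mG2 : measurable_fun setT (fun z : T * n.-tuple T =>
    ((\prod_(i < n) w (lift ord0 i) (tnth z.2 i))%:E * F (tcons z))%E).
  apply: emeasurable_funM.
    by apply: (measurableT_comp (mwp n (fun i => w (lift ord0 i)) _)).
  apply: measurableT_comp => //; exact: measurable_tcons.
have G20 z : (0 <= (\prod_(i < n) w (lift ord0 i) (tnth z.2 i))%:E * F (tcons z))%E.
  by rewrite mule_ge0// lee_fin prodr_ge0.
transitivity (\int[P]_x G (tau ord0 x))%E.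
  apply: eq_integral => x _; rewrite /G.
  rewrite -(IHn (fun i => tau (lift ord0 i)) (fun i => w (lift ord0 i))
     (fun t => F (tcons (tau ord0 x, t))))//.
  - apply: eq_integral => t _; congr F; apply: eq_from_tnth => i.
    rewrite tnth_mktuple; case: (unliftP ord0 i) => [j|] ->.
      by rewrite !tnthS tnth_mktuple.
    by rewrite !tnth0.
  - by move=> i f mf f0; rewrite PQ.
  - apply: measurableT_comp => //; exact: measurable_tcons2.
rewrite PQ; last 2 first.
- exact: (measurable_fun_fubini_tonelli_F _ mG2).
- by move=> x; apply: integral_ge0 => t _; exact: (G20 (x, t)).
apply: eq_integral => x _; rewrite /G -ge0_integralZl//; last 3 first.
- exact: (measurableT_comp mG2 (measurable_pair1 x)).
- by move=> t _; have := G20 (x, t).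
- by rewrite lee_fin.
apply: eq_integral => t _; rewrite muleA; congr (_ * _)%E.
rewrite big_ord_recl /= tnth0 EFinM; congr (_ * _%:E)%E.
by apply: eq_bigr => i _; rewrite tnthS.
Qed.

End iid_integrals.

Lemma integral_iid_pair_prod d1 d2 (T1 : measurableType d1) (T2 : measurableType d2)
    (R : realType) (P : probability T1 R) (Q : probability T2 R) (n : nat)
    (g : T1 * T2 -> \bar R) :
  measurable_fun setT g -> (forall z, 0 <= g z)%E ->
  (\int[iid P n \x iid Q n]_z \prod_(i < n) g (tnth z.1 i, tnth z.2 i) =
   \prod_(i < n) \int[P]_x \int[Q]_y g (x, y))%E.
Proof.
move=> mg g0.
rewrite fubini_tonelli1//; last 2 first.
- apply: emeasurable_fun_prod => i; apply: (measurableT_comp mg).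
  apply: measurable_fun_pair.
    exact: (measurableT_comp (measurable_tnth i) measurable_fst).
  exact: (measurableT_comp (measurable_tnth i) measurable_snd).
- by move=> z; exact: prode_ge0.
rewrite /fubini_F/=.
under eq_integral => x _.
  rewrite (integral_iid_prod _ (g := fun i y => g (tnth x i, y)))//; last first.
    by move=> i; exact: (measurableT_comp mg (measurable_pair1 _)).
  over.
rewrite (integral_iid_prod _ (g := fun i x => \int[Q]_y g (x, y))%E)//.
- move=> i; exact: (measurable_fun_fubini_tonelli_F _ mg).
- by move=> i x; exact: integral_ge0.
Qed.

(** * Gaussian kernels of sums of coordinates *)

Ltac meas := repeat first
  [ exact: measurable_cst | exact: measurable_id | exact: measurable_fst
  | exact: measurable_snd | assumption | exact: measurable_tnth
  | apply: measurable_funX | apply: measurable_funB | apply: measurable_funD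
  | apply: measurable_funM | apply: measurable_funN ].

Section gaussian_rows.
Variable R : realType.
Local Notation N := (normal_law (0 : R) 1).
Local Arguments normal_law : simpl never.

(** For independent standard normal x and z, x + u z is distributed as sqrt (1 + u^2) z. Both sides
    are evaluated by [integral_normal_law_exp]. *)
Lemma integral_normal_law_exp_conv (A B C u : R) : 0 <= A ->
  (\int[N]_x \int[N]_z
     (expR (- A / 2 * (x + u * z) ^+ 2 + B * (x + u * z) + C))%:E =
   \int[N]_z (expR (- A / 2 * (Num.sqrt (1 + u ^+ 2) * z) ^+ 2
     + B * (Num.sqrt (1 + u ^+ 2) * z) + C))%:E)%E.
Proof.
move=> A0.
have u0 : 0 <= u ^+ 2 by exact: sqr_ge0.
have d0 : 0 < 1 + A * u ^+ 2 by rewrite ltr_pwDl// mulr_ge0.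
have d1 : 0 < 1 + A / (1 + A * u ^+ 2) by rewrite ltr_pwDl// divr_ge0// ltW.
have d2 : 0 < 1 + A * (1 + u ^+ 2) by rewrite ltr_pwDl// mulr_ge0// addr_ge0.
have r2 : Num.sqrt (1 + u ^+ 2) ^+ 2 = 1 + u ^+ 2 by rewrite sqr_sqrtr// addr_ge0.
transitivity (\int[N]_x ((Num.sqrt (1 + A * u ^+ 2))^-1%:E *
   (expR (- (A / (1 + A * u ^+ 2)) / 2 * x ^+ 2 + B / (1 + A * u ^+ 2) * x +
    (B ^+ 2 * u ^+ 2 / (2 * (1 + A * u ^+ 2)) + C)))%:E))%E.
  apply: eq_integral => x _.
  transitivity (\int[N]_z (expR (- (A * u ^+ 2) / 2 * z ^+ 2 +
     (B - A * x) * u * z + (- A / 2 * x ^+ 2 + B * x + C)))%:E)%E.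
    by apply: eq_integral => z _; congr (expR _)%:E; field.
  rewrite integral_normal_law_exp// -EFinM; congr (_ * expR _)%:E.
  by field; rewrite gt_eqF.
rewrite ge0_integralZl//; last first.
  by apply/measurable_EFinP; apply: measurableT_comp => //; meas.
rewrite integral_normal_law_exp//.
transitivity (\int[N]_z (expR (- (A * (1 + u ^+ 2)) / 2 * z ^+ 2 +
     (B * Num.sqrt (1 + u ^+ 2)) * z + C))%:E)%E; last first.
  by apply: eq_integral => z _; congr (expR _)%:E; rewrite exprMn r2; ring.
rewrite integral_normal_law_exp// -EFinM mulrA -invfM -sqrtrM ?(ltW d0)//.
congr (_^-1 * expR _)%:E.
  by congr (Num.sqrt _); field; rewrite gt_eqF.
rewrite (exprMn _ B (Num.sqrt _)) r2; field.
by rewrite !gt_eqF//=; lra.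
Qed.

(* exp(-t^2 / 2v) / sqrt v, i.e. the N(0, v) density without the factor
   (2 pi)^(-1/2). *)
Definition gauss_kernel (v t : R) : R :=
  (Num.sqrt v)^-1 * expR (- t ^+ 2 / (2 * v)).

Lemma gauss_kernel_ge0 v t : 0 <= gauss_kernel v t.
Proof. by rewrite mulr_ge0 ?expR_ge0// invr_ge0 sqrtr_ge0. Qed.

Lemma measurable_gauss_kernel v : measurable_fun setT (gauss_kernel v).
Proof.
by apply: measurable_funM => //; apply: measurableT_comp => //; meas.
Qed.

Lemma measurable_gauss_kernel_comp d (T : measurableType d) v (f : T -> R) :
  measurable_fun setT f -> measurable_fun setT (fun x => gauss_kernel v (f x)).
Proof. by move=> mf; exact: (measurableT_comp (measurable_gauss_kernel v) mf). Qed.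

Lemma measurable_expR_comp d (T : measurableType d) (f : T -> R) :
  measurable_fun setT f -> measurable_fun setT (fun x => expR (f x)).
Proof. exact: measurableT_comp. Qed.

Lemma gauss_kernel_conv v a t : 0 < v ->
  (\int[N]_x (gauss_kernel v (t - a * x))%:E = (gauss_kernel (v + a ^+ 2) t)%:E)%E.
Proof.
move=> v0; have a0 : 0 <= a ^+ 2 by exact: sqr_ge0.
have d0 : 0 < 1 + a ^+ 2 / v by rewrite ltr_pwDl// divr_ge0// ltW.
transitivity (\int[N]_x ((Num.sqrt v)^-1%:E * (expR (- (a ^+ 2 / v) / 2 * x ^+ 2 +
    (t * a / v) * x - t ^+ 2 / (2 * v)))%:E))%E.
  apply: eq_integral => x _; rewrite -EFinM; congr (_ * expR _)%:E.
  by field; rewrite gt_eqF.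
rewrite ge0_integralZl//; last first.
  by apply/measurable_EFinP; apply: measurable_expR_comp; meas.
rewrite integral_normal_law_exp// -EFinM mulrA -invfM -sqrtrM ?(ltW v0)//.
congr (_^-1 * expR _)%:E; first by congr (Num.sqrt _); field; rewrite gt_eqF.
by field; rewrite !gt_eqF//=; lra.
Qed.


Lemma gauss_kernel_mul v v' t t' : gauss_kernel v t * gauss_kernel v' t' =
  ((Num.sqrt v)^-1 * (Num.sqrt v')^-1) *
    expR (- t ^+ 2 / (2 * v) - t' ^+ 2 / (2 * v')).
Proof. by rewrite /gauss_kernel mulrACA -expRD !mulNr. Qed.

Definition sum_on (p : nat) (S : 'I_p -> bool) (x : p.-tuple R) : R :=
  \sum_(j < p) (S j)%:R * tnth x j.

Lemma measurable_sum_on p (S : 'I_p -> bool) : measurable_fun setT (sum_on S).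
Proof.
by apply: measurable_sum => j; apply: measurable_funM => //; exact: measurable_tnth.
Qed.

Lemma sum_on_cons p (S : 'I_p.+1 -> bool) x (t : p.-tuple R) :
  sum_on S (tcons (x, t)) = (S ord0)%:R * x + sum_on (fun j => S (lift ord0 j)) t.
Proof.
rewrite /sum_on big_ord_recl /= tnth0; congr (_ + _).
by apply: eq_bigr => j _; rewrite tnthS.
Qed.

Lemma sum_on0 (S : 'I_0 -> bool) t : sum_on S t = 0.
Proof. by rewrite /sum_on big_ord0. Qed.

(** The second moment of a row depends on three linear statistics: [x] over S, [x'] over S', [o]
    over the intersection. The offsets [t], [t'], [b] absorb the coordinates peeled off in the
    induction on [p]. *)
Definition two_kernels (v v' a a' k t t' b x x' o : R) : R :=
  gauss_kernel v (t - a * x) * gauss_kernel v' (t' - a' * x') * expR (k * (b + o)).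

Lemma two_kernels_ge0 v v' a a' k t t' b x x' o :
  0 <= two_kernels v v' a a' k t t' b x x' o.
Proof. by rewrite !mulr_ge0 ?gauss_kernel_ge0 ?expR_ge0. Qed.

Lemma measurable_two_kernels d (T : measurableType d) v v' a a' k
    (t t' b x x' o : T -> R) :
  measurable_fun setT t -> measurable_fun setT t' -> measurable_fun setT b ->
  measurable_fun setT x -> measurable_fun setT x' -> measurable_fun setT o ->
  measurable_fun setT
    (fun z => (two_kernels v v' a a' k (t z) (t' z) (b z) (x z) (x' z) (o z))%:E).
Proof.
move=> mt mt' mb mx mx' mo; apply/measurable_EFinP; apply: measurable_funM.
  by apply: measurable_funM; apply: measurable_gauss_kernel_comp; meas.
by apply: measurable_expR_comp; meas.
Qed.

Lemma two_kernels_diag V V' a a' k t t' b y : 0 < V -> 0 < V' ->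
  two_kernels V V' a a' k t t' b y y y =
  ((Num.sqrt V)^-1 * (Num.sqrt V')^-1) *
   expR (- (a ^+ 2 / V + a' ^+ 2 / V') / 2 * y ^+ 2
      + (t * a / V + t' * a' / V' + k) * y
      + (- t ^+ 2 / (2 * V) - t' ^+ 2 / (2 * V') + k * b)).
Proof.
move=> V0 V'0; rewrite /two_kernels gauss_kernel_mul -[LHS]mulrA -expRD.
by congr (_ * expR _); field; rewrite !gt_eqF.
Qed.

(** A coordinate in both supports moves all three statistics by the same amount, so it merges with
    the Gaussian variable that already carries the intersection. *)
Lemma integral_two_kernels_conv V V' a a' k t t' b r : 0 < V -> 0 < V' ->
  (\int[N]_x \int[N]_z (two_kernels V V' a a' k (t - a * x) (t' - a' * x) (b + x)
      (r * z) (r * z) (r * z))%:E =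
   \int[N]_z (two_kernels V V' a a' k t t' b (Num.sqrt (1 + r ^+ 2) * z)
      (Num.sqrt (1 + r ^+ 2) * z) (Num.sqrt (1 + r ^+ 2) * z))%:E)%E.
Proof.
move=> V0 V'0.
pose A := a ^+ 2 / V + a' ^+ 2 / V'.
pose B := t * a / V + t' * a' / V' + k.
pose C := - t ^+ 2 / (2 * V) - t' ^+ 2 / (2 * V') + k * b.
pose c := (Num.sqrt V)^-1 * (Num.sqrt V')^-1.
have A0 : 0 <= A by rewrite addr_ge0// divr_ge0 ?sqr_ge0// ltW.
have c0 : (0 <= c%:E)%E by rewrite lee_fin mulr_ge0// invr_ge0 sqrtr_ge0.
have E y : (two_kernels V V' a a' k t t' b y y y)%:E =
    (c%:E * (expR (- A / 2 * y ^+ 2 + B * y + C))%:E)%E.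
  by rewrite two_kernels_diag// EFinM.
have shift x z : two_kernels V V' a a' k (t - a * x) (t' - a' * x) (b + x)
      (r * z) (r * z) (r * z) =
    two_kernels V V' a a' k t t' b (x + r * z) (x + r * z) (x + r * z).
  by rewrite /two_kernels !mulrDr !opprD !addrA.
under eq_integral => x _ do under eq_integral => z _ do rewrite shift E.
under [RHS]eq_integral => z _ do rewrite E.
clearbody A B C c; clear E shift.
transitivity (c%:E * \int[N]_x \int[N]_z
    (expR (- A / 2 * (x + r * z) ^+ 2 + B * (x + r * z) + C))%:E)%E.
  rewrite -ge0_integralZl//; last 2 first.
  - apply: (measurable_fun_fubini_tonelli_F (m2 := N) (fun u : R * R => (expR
      (- A / 2 * (u.1 + r * u.2) ^+ 2 + B * (u.1 + r * u.2) + C))%:E)).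
      by apply/measurable_EFinP; apply: measurable_expR_comp; meas.
    by move=> u; rewrite lee_fin expR_ge0.
  - by move=> x _; apply: integral_ge0 => z _; rewrite lee_fin expR_ge0.
  apply: eq_integral => x _; rewrite ge0_integralZl//.
  by apply/measurable_EFinP; apply: measurable_expR_comp; meas.
rewrite integral_normal_law_exp_conv// ge0_integralZl//.
by apply/measurable_EFinP; apply: measurable_expR_comp; meas.
Qed.

(** A coordinate in S alone enters only the first kernel, and Gaussian convolution adds the
    variances. *)
Lemma integral_two_kernels_left V V' a a' k t t' b y : 0 < V ->
  (\int[N]_x (two_kernels V V' a a' k (t - a * x) t' b y y y)%:E =
   (two_kernels (V + a ^+ 2) V' a a' k t t' b y y y)%:E)%E.
Proof.
move=> V0.
transitivity (\int[N]_x ((gauss_kernel V' (t' - a' * y) * expR (k * (b + y)))%:E *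
    (gauss_kernel V ((t - a * y) - a * x))%:E))%E.
  apply: eq_integral => x _; rewrite -EFinM /two_kernels -mulrA mulrC.
  by congr (_ * gauss_kernel _ _)%:E; ring.
rewrite ge0_integralZl//; last 3 first.
- by apply/measurable_EFinP; apply: measurable_gauss_kernel_comp; meas.
- by move=> x _; rewrite lee_fin gauss_kernel_ge0.
- by rewrite lee_fin mulr_ge0 ?gauss_kernel_ge0 ?expR_ge0.
by rewrite gauss_kernel_conv// -EFinM /two_kernels -[in RHS]mulrA [in RHS]mulrC.
Qed.

Lemma two_kernelsC V V' a a' k t t' b y o :
  two_kernels V V' a a' k t t' b y y o = two_kernels V' V a' a k t' t b y y o.
Proof. by rewrite /two_kernels [X in X * _]mulrC. Qed.

(* Integrating out the coordinates outside the intersection of S and S' only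
   widens the two kernels; the coordinates in the intersection act through a
   single Gaussian variable. *)
Lemma integral_two_kernels (p : nat) (S S' : 'I_p -> bool) (v v' a a' k t t' b : R) :
  0 < v -> 0 < v' ->
  (\int[iid N p]_x (two_kernels v v' a a' k t t' b (sum_on S x) (sum_on S' x)
      (sum_on (fun j => S j && S' j) x))%:E =
   \int[N]_z (two_kernels
      (v + a ^+ 2 * (\sum_(j < p) (S j && ~~ S' j))%:R)
      (v' + a' ^+ 2 * (\sum_(j < p) (S' j && ~~ S j))%:R) a a' k t t' b
      (Num.sqrt (\sum_(j < p) (S j && S' j))%:R * z)
      (Num.sqrt (\sum_(j < p) (S j && S' j))%:R * z)
      (Num.sqrt (\sum_(j < p) (S j && S' j))%:R * z))%:E)%E.
Proof.
move=> v0 v'0; elim: p S S' t t' b => [|p IHp] S S' t t' b.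
  rewrite !big_ord0 sqrtr0 /= !mulr0 !addr0.
  under [RHS]eq_integral do rewrite mul0r.
  rewrite integral_dirac//; last first.
    by apply: measurable_two_kernels; meas; exact: measurable_sum_on.
  rewrite diracT !sum_on0 mul1e integral_cst//.
  by rewrite [X in (_ * X)%E]probability_setT mule1.
rewrite ge0_integral_iidS; last 2 first.
- by apply: measurable_two_kernels; meas; exact: measurable_sum_on.
- by move=> x; rewrite lee_fin two_kernels_ge0.
rewrite !big_ord_recl.
set c1 := (\sum_(i < p) _)%N; set c2 := (\sum_(i < p) _)%N; set c := (\sum_(i < p) _)%N.
pose V := v + a ^+ 2 * c1%:R; pose V' := v' + a' ^+ 2 * c2%:R.
pose r := Num.sqrt c%:R : R.
have V0 : 0 < V by rewrite ltr_pwDl// mulr_ge0// sqr_ge0.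
have V'0 : 0 < V' by rewrite ltr_pwDl// mulr_ge0// sqr_ge0.
transitivity (\int[N]_x \int[N]_z
   (two_kernels V V' a a' k (t - a * ((S ord0)%:R * x)) (t' - a' * ((S' ord0)%:R * x))
      (b + (S ord0 && S' ord0)%:R * x) (r * z) (r * z) (r * z))%:E)%E.
  apply: eq_integral => x _; rewrite -IHp; apply: eq_integral => y _.
  by rewrite !sum_on_cons /two_kernels !mulrDr !opprD !addrA.
(* A coordinate lying in exactly one support is integrated before [z], so the two integrals are
   exchanged. *)
have sw : (\int[N]_x \int[N]_z
   (two_kernels V V' a a' k (t - a * ((S ord0)%:R * x)) (t' - a' * ((S' ord0)%:R * x))
      (b + (S ord0 && S' ord0)%:R * x) (r * z) (r * z) (r * z))%:E = \int[N]_z \int[N]_x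
   (two_kernels V V' a a' k (t - a * ((S ord0)%:R * x)) (t' - a' * ((S' ord0)%:R * x))
      (b + (S ord0 && S' ord0)%:R * x) (r * z) (r * z) (r * z))%:E)%E.
  apply: (fubini_tonelli (m1 := N) (m2 := N) (fun u : R * R =>
   (two_kernels V V' a a' k (t - a * ((S ord0)%:R * u.1)) (t' - a' * ((S' ord0)%:R * u.1))
      (b + (S ord0 && S' ord0)%:R * u.1) (r * u.2) (r * u.2) (r * u.2))%:E)).
    by apply: measurable_two_kernels; meas.
  by move=> u; rewrite lee_fin two_kernels_ge0.
have r2 : r ^+ 2 = c%:R by apply: sqr_sqrtr; exact: ler0n.
have VS : V + a ^+ 2 = v + a ^+ 2 * c1.+1%:R by rewrite /V -natr1; ring.
have V'S : V' + a' ^+ 2 = v' + a' ^+ 2 * c2.+1%:R by rewrite /V' -natr1; ring.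
have VE : v + a ^+ 2 * c1%:R = V by [].
have V'E : v' + a' ^+ 2 * c2%:R = V' by [].
have rE : Num.sqrt c%:R = r by [].
have rS : Num.sqrt c.+1%:R = Num.sqrt (1 + r ^+ 2) :> R by rewrite r2 nat1r.
clearbody V V' r c c1 c2.
case: (S ord0) (S' ord0) sw => [] [] /= sw;
  rewrite ?add0n ?add1n ?VE ?V'E ?rE ?rS -?VS -?V'S.
- clear sw; apply: (etrans _ (integral_two_kernels_conv a a' k t t' b r V0 V'0)).
  apply: eq_integral => x _.
  by apply: eq_integral => z _; rewrite !mul1r.
- rewrite {}sw; apply: eq_integral => z _.
  apply: (etrans _ (integral_two_kernels_left V' a a' k t t' b (r * z) V0)).
  by apply: eq_integral => x _; rewrite mul1r !mul0r mulr0 subr0 addr0.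
- rewrite {}sw; apply: eq_integral => z _; rewrite two_kernelsC.
  apply: (etrans _ (integral_two_kernels_left V a' a k t' t b (r * z) V'0)).
  apply: eq_integral => x _.
  by rewrite mul1r !mul0r mulr0 subr0 addr0 two_kernelsC.
- clear sw; under eq_integral => x _ do rewrite !mul0r !mulr0 !subr0 addr0.
  rewrite integral_cst//.
  by rewrite [X in (_ * X)%E]probability_setT mule1.
Qed.

End gaussian_rows.

(** * Likelihood ratio of a row *)

Section row_likelihood.
Variable R : realType.
Local Notation N := (normal_law (0 : R) 1).
Local Arguments normal_law : simpl never.

Lemma normal_lr_kernel (c s y : R) : 0 < s ->
  normal_lr c s y = expR (y ^+ 2 / 2) * gauss_kernel (s ^+ 2) (y - c).
Proof.
move=> s0; rewrite /normal_lr /gauss_kernel sqrtr_sqr gtr0_norm// expRD mulNr.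
by rewrite [RHS]mulrCA.
Qed.

Definition row_lr (p : nat) (a s : R) (S : 'I_p -> bool) (z : p.-tuple R * R) : R :=
  normal_lr (a * sum_on S z.1) s z.2.

Lemma row_lr_ge0 p a s S z : 0 <= s -> 0 <= @row_lr p a s S z.
Proof. exact: normal_lr_ge0. Qed.

Lemma measurable_row_lr p a s S : measurable_fun setT (@row_lr p a s S).
Proof.
have mc : measurable_fun setT (fun z : p.-tuple R * R => (a * sum_on S z.1, z.2)).
  apply: measurable_fun_pair => //; apply: measurable_funM => //.
  exact: (measurableT_comp (measurable_sum_on S) measurable_fst).
exact: (measurableT_comp (measurable_normal_lr s) mc).
Qed.

Local Notation cnt S := (\sum_(j < _) (S j : bool))%N.

Lemma integral_two_kernels_diag V V' a a' k t t' b u : 0 < V -> 0 < V' ->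
  (\int[N]_z (two_kernels V V' a a' k t t' b (u * z) (u * z) (u * z))%:E =
   (((Num.sqrt V)^-1 * (Num.sqrt V')^-1) *
    ((Num.sqrt (1 + (a ^+ 2 / V + a' ^+ 2 / V') * u ^+ 2))^-1 *
     expR ((t * a / V + t' * a' / V' + k) ^+ 2 * u ^+ 2 /
        (2 * (1 + (a ^+ 2 / V + a' ^+ 2 / V') * u ^+ 2)) +
       (- t ^+ 2 / (2 * V) - t' ^+ 2 / (2 * V') + k * b))))%:E)%E.
Proof.
move=> V0 V'0.
have d0 : 0 < 1 + (a ^+ 2 / V + a' ^+ 2 / V') * u ^+ 2.
  by rewrite ltr_pwDl// mulr_ge0 ?sqr_ge0// addr_ge0// divr_ge0 ?sqr_ge0// ltW.
under eq_integral => z _.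
  rewrite two_kernels_diag// EFinM (_ : expR _ = expR
    (- ((a ^+ 2 / V + a' ^+ 2 / V') * u ^+ 2) / 2 * z ^+ 2 +
     ((t * a / V + t' * a' / V' + k) * u) * z +
     (- t ^+ 2 / (2 * V) - t' ^+ 2 / (2 * V') + k * b))); last first.
    by congr expR; field; rewrite !gt_eqF.
  over.
rewrite ge0_integralZl//; last first.
  by apply/measurable_EFinP; apply: measurable_expR_comp; meas.
by rewrite integral_normal_law_exp// -EFinM exprMn.
Qed.

(* [l] is the Chernoff weight of the truncation; for [l = 0] the value is
   (1 - a ^+ 2 * o)^-1 = (1 - <theta, theta'>)^-1. *)
Lemma integral_row_lr2 (p K : nat) (a s l : R) (S S' : 'I_p -> bool) :
  0 < s -> s ^+ 2 = 1 - a ^+ 2 * K%:R -> cnt S = K -> cnt S' = K ->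
  let o := (\sum_(j < p) (S j && S' j))%:R : R in
  let D := (1 - a ^+ 2 * o) ^+ 2 + 4 * a * l * o * (1 - a ^+ 2 * o)
     - l ^+ 2 * o * (1 - a ^+ 2 * o) ^+ 2 in
  0 < D ->
  (\int[iid N p]_x \int[N]_y (row_lr a s S (x, y) * row_lr a s S' (x, y) *
     expR (- l * y * sum_on (fun j => S j && S' j) x))%:E = ((Num.sqrt D)^-1)%:E)%E.
Proof.
move=> s0 sE cS cS' o D D0.
have s20 : 0 < s ^+ 2 by rewrite exprn_gt0.
have n1 : (\sum_(j < p) (S j && ~~ S' j))%:R = K%:R - o.
  rewrite -cS /o -natrB; last by apply: leq_sum => j _; case: (S j) (S' j) => [] [].
  congr _%:R; rewrite -sumnB//; last by move=> j _; case: (S j) (S' j) => [] [].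
  by apply: eq_bigr => j _; case: (S j) (S' j) => [] [].
have n2 : (\sum_(j < p) (S' j && ~~ S j))%:R = K%:R - o.
  rewrite -cS' /o -natrB; last by apply: leq_sum => j _; case: (S j) (S' j) => [] [].
  congr _%:R; rewrite -sumnB//; last by move=> j _; case: (S j) (S' j) => [] [].
  by apply: eq_bigr => j _; case: (S j) (S' j) => [] [].
have o0 : 0 <= o by [].
have oK : o <= K%:R.
  by rewrite -cS /o ler_nat; apply: leq_sum => j _; case: (S j) (S' j) => [] [].
(* The variance of the response given the common coordinates: the remaining active coordinates act
   as extra noise. *)
pose V := 1 - a ^+ 2 * o.
have VE : s ^+ 2 + a ^+ 2 * (K%:R - o) = V by rewrite sE /V; ring.
have V0 : 0 < V.
  by rewrite -VE ltr_pwDl// mulr_ge0 ?sqr_ge0// subr_ge0.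
have W0 : 0 < 1 + a ^+ 2 * o by rewrite ltr_pwDl// mulr_ge0// sqr_ge0.
rewrite (fubini_tonelli (m1 := iid N p) (m2 := N) (fun z : p.-tuple R * R =>
  (row_lr a s S z * row_lr a s S' z *
     expR (- l * z.2 * sum_on (fun j => S j && S' j) z.1))%:E)); last 2 first.
- apply/measurable_EFinP; apply: measurable_funM.
    by apply: measurable_funM; exact: measurable_row_lr.
  apply: measurable_expR_comp; apply: measurable_funM; first by meas.
  exact: (measurableT_comp (measurable_sum_on _) measurable_fst).
- move=> z; rewrite lee_fin; apply: mulr_ge0; last exact: expR_ge0.
  by apply: mulr_ge0; apply: row_lr_ge0; exact: ltW.
pose B := 1 + (a ^+ 2 / V + a ^+ 2 / V) * o.
have BE : B = (1 + a ^+ 2 * o) / V by rewrite /B /V; field; rewrite -/V gt_eqF.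
have B0 : 0 < B by rewrite BE divr_gt0.
(* With the row integrated out, the exponent left in y is - A2 y^2 / 2; the normalizations V, V, B
   and 1 + A2 multiply to [D]. *)
pose A2 := - 2 * (1 - V^-1 + (2 * a / V - l) ^+ 2 * o / (2 * B)).
have AE : 1 + A2 = D / (V * (1 + a ^+ 2 * o)).
  rewrite /A2 BE /D -/V /V; field.
  by rewrite -/V !gt_eqF.
have A20 : 0 < 1 + A2 by rewrite AE divr_gt0// mulr_gt0.
transitivity (\int[N]_y ((((Num.sqrt V)^-1 * (Num.sqrt V)^-1) * (Num.sqrt B)^-1)%:E
   * (expR (- A2 / 2 * y ^+ 2 + 0 * y + 0))%:E))%E.
  apply: eq_integral => y _.
  transitivity (\int[iid N p]_x ((expR (y ^+ 2))%:E *
     (two_kernels (s ^+ 2) (s ^+ 2) a a (- l * y) y y 0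
     (sum_on S x) (sum_on S' x) (sum_on (fun j => S j && S' j) x))%:E))%E.
    apply: eq_integral => x _; rewrite -EFinM; congr EFin.
    rewrite /row_lr !normal_lr_kernel//= /two_kernels add0r mulrACA -expRD.
    by rewrite -[LHS]mulrA; congr (expR _ * _); field.
  rewrite ge0_integralZl//; last 2 first.
  - by apply: measurable_two_kernels; meas; exact: measurable_sum_on.
  - by move=> x _; rewrite lee_fin two_kernels_ge0.
  rewrite integral_two_kernels// n1 n2 VE -/o integral_two_kernels_diag//.
  rewrite sqr_sqrtr// -/B -!EFinM; congr EFin.
  rewrite mulrCA -[RHS]mulrA; congr (_ * _); rewrite mulrCA; congr (_ * _).
  rewrite -expRD; congr expR; rewrite /A2 -/B; field.
  by rewrite !gt_eqF.
rewrite ge0_integralZl//; last first.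
  by apply/measurable_EFinP; apply: measurable_expR_comp; meas.
rewrite integral_normal_law_exp// -EFinM expr0n mul0r addr0 expR0 mulr1.
rewrite -!invfM -!sqrtrM ?(ltW V0) ?mulr_ge0 ?(ltW V0) ?(ltW B0)//.
congr ((Num.sqrt _)^-1)%:E.
by rewrite AE BE; field; rewrite !gt_eqF.
Qed.

(** Under the alternative, X_j and Y are standard normal with covariance [a]; the value is the
    moment generating function of their product at [m]. *)
Lemma integral_row_lr_exp (p K : nat) (a s m : R) (S : 'I_p -> bool) (j : 'I_p) :
  0 < s -> s ^+ 2 = 1 - a ^+ 2 * K%:R -> cnt S = K -> S j ->
  0 < 1 - 2 * m * a - m ^+ 2 * (1 - a ^+ 2) ->
  (\int[iid N p]_x \int[N]_y (row_lr a s S (x, y) * expR (m * (tnth x j * y)))%:E =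
   ((Num.sqrt (1 - 2 * m * a - m ^+ 2 * (1 - a ^+ 2)))^-1)%:E)%E.
Proof.
move=> s0 sE cS Sj D0.
have s20 : 0 < s ^+ 2 by rewrite exprn_gt0.
have sum1 : (\sum_(i < p) (S i && (i == j)) = 1)%N.
  by rewrite (bigD1 j)//= Sj eqxx big1// => i /negbTE ->; rewrite andbF.
have sum0 : (\sum_(i < p) ((i == j) && ~~ S i) = 0)%N.
  by apply: big1 => i _; case: eqP => // ->; rewrite Sj.
have n1 : (\sum_(i < p) (S i && ~~ (i == j)))%:R = K%:R - 1 :> R.
  apply/eqP; rewrite eq_sym subr_eq natr1 -addn1 -sum1 -cS -big_split/=.
  by apply/eqP; congr _%:R; apply: eq_bigr => i _; case: (S i) (i == j) => [] [].
have sumj (x : p.-tuple R) : sum_on (fun i => S i && (i == j)) x = tnth x j.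
  rewrite /sum_on (bigD1 j)//= Sj eqxx mul1r big1 ?addr0// => i /negbTE ->.
  by rewrite andbF mul0r.
have K1 : 1 <= K%:R :> R by rewrite -subr_ge0 -n1.
pose V := 1 - a ^+ 2.
have VE : s ^+ 2 + a ^+ 2 * (K%:R - 1) = V by rewrite sE /V; ring.
have V0 : 0 < V.
  by rewrite -VE ltr_pwDl// mulr_ge0 ?sqr_ge0// subr_ge0.
rewrite (fubini_tonelli (m1 := iid N p) (m2 := N) (fun z : p.-tuple R * R =>
  (row_lr a s S z * expR (m * (tnth z.1 j * z.2)))%:E)); last 2 first.
- apply/measurable_EFinP; apply: measurable_funM; first exact: measurable_row_lr.
  apply: measurable_expR_comp; apply: measurable_funM => //; apply: measurable_funM => //.
  exact: (measurableT_comp (measurable_tnth j) measurable_fst).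
- move=> z; rewrite lee_fin; apply: mulr_ge0; last exact: expR_ge0.
  by apply: row_lr_ge0; exact: ltW.
pose D := 1 - 2 * m * a - m ^+ 2 * V.
transitivity (\int[N]_y (expR (- (D - 1) / 2 * y ^+ 2 + 0 * y + 0))%:E)%E.
  apply: eq_integral => y _.
  (* The two-kernel integral with second support {j} and a' = 0: the second kernel is constantly 1
     and the overlap statistic is X_j. *)
  transitivity (\int[iid N p]_x ((expR (y ^+ 2 / 2))%:E *
     (two_kernels (s ^+ 2) 1 a 0 (m * y) y 0 0
     (sum_on S x) (sum_on (fun i => i == j) x)
     (sum_on (fun i => S i && (i == j)) x))%:E))%E.
    apply: eq_integral => x _; rewrite -EFinM; congr EFin.
    rewrite /row_lr !normal_lr_kernel//= /two_kernels mul0r subr0 add0r.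
    rewrite [gauss_kernel 1 0]/gauss_kernel expr0n oppr0 mul0r expR0 sqrtr1 invr1 !mulr1.
    by rewrite sumj -mulrA; congr (_ * (_ * expR _)); ring.
  rewrite ge0_integralZl//; last 2 first.
  - by apply: measurable_two_kernels; meas; exact: measurable_sum_on.
  - by move=> x _; rewrite lee_fin two_kernels_ge0.
  rewrite integral_two_kernels// n1 sum1 sum0 VE mulr0 addr0 integral_two_kernels_diag//.
  rewrite sqrtr1 expr1n !mulr1 -!EFinM; congr EFin.
  rewrite (expr0n _ 2) /= !(mul0r, invr1, mulr1, mulr0, addr0, subr0).
  rewrite (_ : 1 + a ^+ 2 / V = V^-1); last by rewrite /V; field; rewrite -/V gt_eqF.
  rewrite sqrtrV ?(ltW V0)// invrK mulrA mulVf ?gt_eqF ?sqrtr_gt0// mul1r -expRD.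
  congr expR; rewrite /D /V; field.
  by rewrite -/V gt_eqF.
rewrite integral_normal_law_exp; last by rewrite addrC subrK.
by rewrite expr0n mul0r addr0 expR0 mulr1 addrC subrK.
Qed.

End row_likelihood.

(** * Likelihood ratio of the sample *)

Section likelihood.
Variable R : realType.
Variables (n p : nat) (a s : R).
Hypothesis s0 : 0 < s.
Local Notation N := (normal_law (0 : R) 1).
Local Arguments normal_law : simpl never.
Implicit Types (S : 'I_p -> bool) (z : data R n p).

Let P0 := (iid (iid N p) n \x iid N n)%E.

Definition lr S z : R := \prod_(i < n) row_lr a s S (tnth z.1 i, tnth z.2 i).

Lemma lr_ge0 S z : 0 <= lr S z.
Proof. by apply: prodr_ge0 => i _; apply: row_lr_ge0; exact: ltW. Qed.

Lemma measurable_row_pair (i : 'I_n) :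
  measurable_fun setT (fun z : data R n p => (tnth z.1 i, tnth z.2 i)).
Proof.
apply: measurable_fun_pair.
  exact: (measurableT_comp (measurable_tnth i) measurable_fst).
exact: (measurableT_comp (measurable_tnth i) measurable_snd).
Qed.

Lemma measurable_lr S : measurable_fun setT (lr S).
Proof.
apply: measurable_prod => i _.
exact: (measurableT_comp (measurable_row_lr a s S) (measurable_row_pair i)).
Qed.

Definition support_vector S : 'rV[R]_p := \row_j (a * (S j)%:R).

(** Conditionally on the design, the responses are independent shifted Gaussians, so the measure is
    changed row by row. *)
Lemma integral_gaussian_law_lr S (f : data R n p -> \bar R) :
  measurable_fun setT f -> (forall z, 0 <= f z)%E ->
  (\int[gaussian_law n (support_vector S) s]_z f z =
   \int[P0]_z ((lr S z)%:E * f z))%E.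
Proof.
move=> mf f0.
rewrite /gaussian_law (ge0_integral_distribution _ mf f0).
have mfo : measurable_fun setT (f \o @observe R n p (support_vector S)).
  by apply: measurableT_comp => //; exact: measurable_observe.
have mlf : measurable_fun setT (fun z => (lr S z)%:E * f z)%E.
  by apply: emeasurable_funM => //; apply/measurable_EFinP; exact: measurable_lr.
have fo0 z : (0 <= (f \o @observe R n p (support_vector S)) z)%E by exact: f0.
have lf0 z : (0 <= (lr S z)%:E * f z)%E by rewrite mule_ge0// lee_fin lr_ge0.
apply: (etrans (fubini_tonelli1
  (m1 := iid (iid N p) n) (m2 := iid (normal_law 0 s) n) _ mfo fo0)).
apply: (etrans _ (esym (fubini_tonelli1
  (m1 := iid (iid N p) n) (m2 := iid N n) _ mlf lf0))).
apply: eq_integral => X _; rewrite /fubini_F /=.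
pose tau (i : 'I_n) (y : R) := a * sum_on S (tnth X i) + y.
pose w (i : 'I_n) := normal_lr (a * sum_on S (tnth X i)) s.
have mtau i : measurable_fun setT (tau i) by exact: measurable_funD.
have mw i : measurable_fun setT (w i).
  exact: (measurableT_comp (measurable_normal_lr s) (measurable_pair1 _)).
have w0 i x : 0 <= w i x by apply: normal_lr_ge0; exact: ltW.
have shift i (g : R -> \bar R) : measurable_fun setT g -> (forall x, 0 <= g x)%E ->
    (\int[normal_law 0 s]_x g (tau i x) = \int[N]_x ((w i x)%:E * g x))%E.
  by move=> mg g0; exact: ge0_integral_normal_law_shift.
have mF : measurable_fun setT (fun Y => f (X, Y)).
  exact: (measurableT_comp mf (measurable_pair1 X)).
apply: (etrans _ (ge0_integral_iid_density mtau mw w0 shift mF (fun Y => f0 (X, Y)))).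
apply: eq_integral => xi _; congr (f (_, _)); apply: eq_from_tnth => i.
rewrite !tnth_mktuple; congr (_ + _); rewrite /sum_on mulr_sumr.
by apply: eq_bigr => j _; rewrite mxE mulrA.
Qed.

Lemma integral_gaussian_law0 (f : data R n p -> \bar R) :
  measurable_fun setT f -> (forall z, 0 <= f z)%E ->
  (\int[gaussian_law n (0 : 'rV_p) 1]_z f z = \int[P0]_z f z)%E.
Proof.
move=> mf f0.
rewrite /gaussian_law (ge0_integral_distribution _ mf f0).
apply: eq_integral => -[X Y] _; congr (f (_, _)); apply: eq_from_tnth => i.
by rewrite tnth_mktuple big1 ?add0r// => j _; rewrite mxE mul0r.
Qed.

Lemma integral_lr S : (\int[P0]_z (lr S z)%:E = 1)%E.
Proof.
under eq_integral do rewrite -[X in X%:E]mulr1 EFinM.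
rewrite -integral_gaussian_law_lr// integral_cst// mul1e.
exact: probability_setT.
Qed.

Definition inner_stat (j : 'I_p) z : R := \sum_(i < n) tnth (tnth z.1 i) j * tnth z.2 i.

Lemma measurable_inner_stat j : measurable_fun setT (inner_stat j).
Proof.
apply: measurable_sum => i; apply: measurable_funM.
  apply: (measurableT_comp (measurable_tnth j)).
  exact: (measurableT_comp (measurable_tnth i) measurable_fst).
exact: (measurableT_comp (measurable_tnth i) measurable_snd).
Qed.

Variable T : R.

Definition trunc S z : R := \prod_(j < p) (S j ==> (inner_stat j z <= T))%:R.

Lemma trunc_ge0 S z : 0 <= trunc S z.
Proof. exact: prodr_ge0. Qed.

Lemma trunc_le1 S z : trunc S z <= 1.
Proof. by apply: prodr_ile1 => j _; case: (_ ==> _); rewrite ?lexx ?ler01. Qed.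

Lemma measurable_trunc S : measurable_fun setT (trunc S).
Proof.
apply: measurable_prod => j _; case: (S j) => /=; last exact: measurable_cst.
apply: (measurableT_comp (f := fun b : bool => b%:R : R)) => //.
by apply: measurable_fun_ler => //; exact: measurable_inner_stat.
Qed.

(** On common coordinates the indicator of u <= T is at most exp (l (T - u)); the other indicators
    are bounded by 1. The result is regrouped over rows, which are independent. *)
Lemma trunc_overlap_le S S' (l : R) z : 0 <= l ->
  trunc S z * trunc S' z <=
  expR (l * T * (\sum_(j < p) (S j && S' j))%:R) *
  \prod_(i < n) expR (- l * tnth z.2 i * sum_on (fun j => S j && S' j) (tnth z.1 i)).
Proof.
move=> l0; rewrite -big_split/=.
apply: (@le_trans _ _ (\prod_(j < p) expR (l * (S j && S' j)%:R * (T - inner_stat j z)))).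
  apply: ler_prod => j _; rewrite mulr_ge0//=.
  case: (leP (inner_stat j z) T) => h; case: (S j); case: (S' j) => /=;
    rewrite ?(mulr1, mulr0, mul0r, expR0, expR_ge0, lexx, ler01)//.
  by rewrite -expR0 ler_expR mulr_ge0// subr_ge0.
rewrite -!expR_sum -expRD ler_expR.
rewrite natr_sum mulr_sumr [X in _ <= _ + X](_ : _ =
  \sum_(j < p) - (l * (S j && S' j)%:R * inner_stat j z)).
  by rewrite -big_split/=; apply: ler_sum => j _; rewrite mulrBr mulrAC.
under eq_bigr do rewrite /sum_on mulr_sumr.
rewrite exchange_big/=; apply: eq_bigr => j _.
by rewrite /inner_stat mulr_sumr -sumrN; apply: eq_bigr => i _; ring.
Qed.

Lemma integral_lr2_trunc (K : nat) S S' (l : R) :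
  0 <= l -> s ^+ 2 = 1 - a ^+ 2 * K%:R ->
  (\sum_(j < p) S j = K)%N -> (\sum_(j < p) S' j = K)%N ->
  let o := (\sum_(j < p) (S j && S' j))%:R : R in
  let D := (1 - a ^+ 2 * o) ^+ 2 + 4 * a * l * o * (1 - a ^+ 2 * o)
     - l ^+ 2 * o * (1 - a ^+ 2 * o) ^+ 2 in
  0 < D ->
  (\int[P0]_z (lr S z * trunc S z * (lr S' z * trunc S' z))%:E <=
   (expR (l * T * o) * (Num.sqrt D)^-1 ^+ n)%:E)%E.
Proof.
move=> l0 sE cS cS' o D D0.
pose g (u : p.-tuple R * R) := row_lr a s S u * row_lr a s S' u *
  expR (- l * u.2 * sum_on (fun j => S j && S' j) u.1).
have mg : measurable_fun setT (EFin \o g).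
  apply/measurable_EFinP; apply: measurable_funM.
    by apply: measurable_funM; exact: measurable_row_lr.
  apply: measurable_expR_comp; apply: measurable_funM; first by meas.
  exact: (measurableT_comp (measurable_sum_on _) measurable_fst).
have g0 u : (0 <= (EFin \o g) u)%E.
  rewrite lee_fin; apply: mulr_ge0; last exact: expR_ge0.
  by apply: mulr_ge0; apply: row_lr_ge0; exact: ltW.
have gi : (\int[P0]_z \prod_(i < n) (EFin \o g) (tnth z.1 i, tnth z.2 i) =
    ((Num.sqrt D)^-1 ^+ n)%:E)%E.
  rewrite (integral_iid_pair_prod _ _ n mg g0).
  have -> : (\int[iid N p]_x \int[N]_y (EFin \o g) (x, y) = ((Num.sqrt D)^-1)%:E)%E.
    exact: (integral_row_lr2 s0 sE cS cS' D0).
  by rewrite prodEFin prodr_const card_ord.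
have mgp : measurable_fun setT (fun z : data R n p =>
    \prod_(i < n) (EFin \o g) (tnth z.1 i, tnth z.2 i))%E.
  apply: emeasurable_fun_prod => i.
  exact: (measurableT_comp mg (measurable_row_pair i)).
rewrite EFinM -gi -ge0_integralZl//; last by move=> z _; exact: prode_ge0.
apply: ge0_le_integral => //.
- move=> z _; rewrite lee_fin; apply: mulr_ge0; apply: mulr_ge0;
    by rewrite ?lr_ge0 ?trunc_ge0.
- apply/measurable_EFinP; apply: measurable_funM; apply: measurable_funM;
    by [exact: measurable_lr|exact: measurable_trunc].
- exact: emeasurable_funM.
- move=> z _; rewrite prodEFin -EFinM lee_fin.
  rewrite (_ : \prod_(i < n) _ = lr S z * lr S' z * \prod_(i < n)
    expR (- l * tnth z.2 i * sum_on (fun j => S j && S' j) (tnth z.1 i))); last first.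
    by rewrite /lr -!big_split.
  rewrite mulrACA [leRHS]mulrCA ler_wpM2l//; last exact: trunc_overlap_le.
  by apply: mulr_ge0; exact: lr_ge0.
Qed.

(** Union bound and Chernoff: the mass lost by truncation is at most the sum over j in S of
    E[L_S exp (m (<X_j, Y> - T))]. *)
Lemma integral_lr_trunc (K : nat) S (m : R) :
  0 <= m -> s ^+ 2 = 1 - a ^+ 2 * K%:R -> (\sum_(j < p) S j = K)%N ->
  let D := 1 - 2 * m * a - m ^+ 2 * (1 - a ^+ 2) in 0 < D ->
  (1 <= \int[P0]_z (lr S z * trunc S z)%:E +
    (K%:R * (expR (- m * T) * (Num.sqrt D)^-1 ^+ n))%:E)%E.
Proof.
move=> m0 sE cS D D0.
pose e j z := lr S z * expR (m * inner_stat j z).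
have me j : measurable_fun setT (e j).
  apply: measurable_funM; first exact: measurable_lr.
  apply: measurable_expR_comp; apply: measurable_funM => //.
  exact: measurable_inner_stat.
have e0 j z : 0 <= e j z by rewrite mulr_ge0 ?lr_ge0 ?expR_ge0.
have ei j : S j -> (\int[P0]_z (e j z)%:E = ((Num.sqrt D)^-1 ^+ n)%:E)%E.
  move=> Sj.
  pose g (u : p.-tuple R * R) := row_lr a s S u * expR (m * (tnth u.1 j * u.2)).
  have mg : measurable_fun setT (EFin \o g).
    apply/measurable_EFinP; apply: measurable_funM; first exact: measurable_row_lr.
    apply: measurable_expR_comp; apply: measurable_funM => //.
    apply: measurable_funM => //.
    exact: (measurableT_comp (measurable_tnth j) measurable_fst).
  have g0 u : (0 <= (EFin \o g) u)%E.
    rewrite lee_fin; apply: mulr_ge0; last exact: expR_ge0.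
    by apply: row_lr_ge0; exact: ltW.
  transitivity (\int[P0]_z \prod_(i < n) (EFin \o g) (tnth z.1 i, tnth z.2 i))%E.
    apply: eq_integral => z _; rewrite prodEFin; congr EFin.
    by rewrite /e /inner_stat mulr_sumr expR_sum /lr -big_split.
  rewrite (integral_iid_pair_prod _ _ n mg g0).
  have -> : (\int[iid N p]_x \int[N]_y (EFin \o g) (x, y) = ((Num.sqrt D)^-1)%:E)%E.
    exact: (integral_row_lr_exp s0 sE cS Sj D0).
  by rewrite prodEFin prodr_const card_ord.
have mt : measurable_fun setT (fun z => lr S z * trunc S z).
  by apply: measurable_funM; [exact: measurable_lr|exact: measurable_trunc].
have c0 j : (0 <= ((S j)%:R * expR (- m * T))%:E)%E.
  by rewrite lee_fin mulr_ge0 ?expR_ge0.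
have ce0 j z : (0 <= ((S j)%:R * expR (- m * T))%:E * (e j z)%:E)%E.
  by rewrite mule_ge0// lee_fin.
have sume : (\int[P0]_z \sum_(j < p) ((S j)%:R * expR (- m * T))%:E * (e j z)%:E =
    (K%:R * (expR (- m * T) * (Num.sqrt D)^-1 ^+ n))%:E)%E.
  rewrite ge0_integral_sum//; last first.
    by move=> j; apply: emeasurable_funM => //; exact/measurable_EFinP.
  rewrite -cS natr_sum mulr_suml -sumEFin; apply: eq_bigr => j _.
  rewrite ge0_integralZl//; last 2 first.
  - exact/measurable_EFinP.
  - by move=> z _; rewrite lee_fin.
  case Sj: (S j); last by rewrite !mul0r mul0e.
  by rewrite ei// -EFinM !mul1r.
rewrite -sume -ge0_integralD//; last 4 first.
- by move=> z _; rewrite lee_fin mulr_ge0 ?lr_ge0 ?trunc_ge0.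
- exact/measurable_EFinP.
- by move=> z _; apply: sume_ge0 => j _; exact: ce0.
- apply: emeasurable_sum => j; apply: emeasurable_funM => //; exact/measurable_EFinP.
rewrite -(integral_lr S); apply: ge0_le_integral => //.
- by move=> z _; rewrite lee_fin lr_ge0.
- by apply/measurable_EFinP; exact: measurable_lr.
- apply: emeasurable_funD; first exact/measurable_EFinP.
  apply: emeasurable_sum => j; apply: emeasurable_funM => //; exact/measurable_EFinP.
move=> z _; rewrite sumEFin -EFinD lee_fin.
under eq_bigr => j _ do rewrite /e mulrCA -mulrA -expRD.
rewrite -mulr_sumr -mulrDr ler_peMr ?lr_ge0//.
have sum0 j : 0 <= (S j)%:R * expR (- m * T + m * inner_stat j z).
  by rewrite mulr_ge0 ?expR_ge0.
(* Pointwise, either nothing is truncated or some term of the sum is at least 1. *)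
have [/forallP h|] := boolP [forall j, S j ==> (inner_stat j z <= T)].
  rewrite /trunc big1 ?lerDl ?sumr_ge0// => j _.
  by rewrite (h j).
rewrite negb_forall => /existsP[j]; rewrite negb_imply -ltNge => /andP[Sj hj].
rewrite (bigD1 j)//= Sj mul1r.
have h1 : 1 <= expR (- m * T + m * inner_stat j z).
  by rewrite -expR0 ler_expR mulNr addrC -mulrBr mulr_ge0// subr_ge0 ltW.
have := trunc_ge0 S z.
have : 0 <= \sum_(i < p | i != j) (S i)%:R * expR (- m * T + m * inner_stat i z).
  exact: sumr_ge0.
lra.
Qed.

End likelihood.

(** * Truncated second moments *)

Lemma bayes_risk_ge_quadratic (R : realType) (eps w L G : R) :
  0 < eps -> 0 <= w <= 1 -> 0 <= G <= L ->
  1 + eps^-1 * G <= w + L * (1 - w) + (2 * eps)^-1 * (G ^+ 2 + 1) + eps / 2.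
Proof.
move=> e0 /andP[w0 w1] /andP[G0 GL].
(* w + L (1 - w) >= min(1, L) >= 1 - |1 - G|, and by AM-GM
   |1 - G| <= (1 - G)^2 / (2 eps) + eps / 2. *)
have h : (2 * eps)^-1 * (G ^+ 2 + 1) - eps^-1 * G = (2 * eps)^-1 * (G - 1) ^+ 2.
  by field; rewrite gt_eqF.
have sq : 0 <= (2 * eps)^-1 * (1 - G - eps) ^+ 2.
  by rewrite mulr_ge0 ?sqr_ge0// invr_ge0 mulr_ge0// ltW.
have sqE : (2 * eps)^-1 * (1 - G - eps) ^+ 2 =
    (2 * eps)^-1 * (G - 1) ^+ 2 + eps / 2 - (1 - G).
  by field; rewrite gt_eqF.
have sq' : 0 <= (2 * eps)^-1 * (G - 1) ^+ 2.
  by rewrite mulr_ge0 ?sqr_ge0// invr_ge0 mulr_ge0// ltW.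
have [L1|L1] := leP L 1.
  have : 0 <= w * (1 - L) by rewrite mulr_ge0 ?subr_ge0.
  lra.
have : 0 <= (L - 1) * (1 - w) by rewrite mulr_ge0 ?subr_ge0 ?(ltW L1).
lra.
Qed.

Lemma ge0_integral_sum_EFinZ d (Z : measurableType d) (R : realType)
    (P : {measure set Z -> \bar R}) (J : finType) (c : R) (f : J -> Z -> R) :
  0 <= c -> (forall j, measurable_fun setT (f j)) -> (forall j z, 0 <= f j z) ->
  (\int[P]_z (\sum_j c * f j z)%:E = \sum_j c%:E * \int[P]_z (f j z)%:E)%E.
Proof.
move=> c0 mf f0; under eq_integral do rewrite -sumEFin.
rewrite ge0_integral_sum//; last 2 first.
- by move=> j; apply/measurable_EFinP; exact: measurable_funM.
- by move=> j z _; rewrite lee_fin mulr_ge0.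
apply: eq_bigr => j _; under eq_integral do rewrite EFinM.
rewrite ge0_integralZl//; first exact/measurable_EFinP.
by move=> z _; rewrite lee_fin.
Qed.

(* A truncated second moment method: [g i] is the truncated likelihood ratio
   of the i-th alternative. *)
Lemma mixture_second_moment d (Z : measurableType d) (R : realType)
    (P : probability Z R) (I : finType) (i0 : I) (psi : Z -> R) (l g : I -> Z -> R)
    (eps eta W e0 : R) (b : I -> R) (v : I -> I -> R) :
  0 < eps -> measurable_fun setT psi -> (forall z, 0 <= psi z <= 1) ->
  (forall i, measurable_fun setT (l i)) -> (forall i, measurable_fun setT (g i)) ->
  (forall i z, 0 <= g i z <= l i z) ->
  (\int[P]_z (psi z)%:E = e0%:E)%E ->
  (forall i, \int[P]_z (l i z * (1 - psi z))%:E = (b i)%:E)%E ->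
  (forall i, 1 <= \int[P]_z (g i z)%:E + eta%:E)%E ->
  (forall i j, \int[P]_z (g i z * g j z)%:E <= (v i j)%:E)%E ->
  \sum_i \sum_j v i j <= #|I|%:R ^+ 2 * W ->
  1 - eps / 2 - (W - 1 + 2 * eta) / (2 * eps) <= e0 + #|I|%:R^-1 * \sum_i b i.
Proof.
move=> eps0 mpsi psi01 ml mg gl e0E bE etaE vE vW.
pose M : R := #|I|%:R.
have M0 : 0 < M by rewrite ltr0n; apply/card_gt0P; exists i0.
have g0 i z : 0 <= g i z by have /andP[] := gl i z.
have l0 i z : 0 <= l i z by have /andP[g_ge0 g_le] := gl i z; exact: le_trans g_le.
have psi0 z : 0 <= psi z by have /andP[] := psi01 z.
have psi1 z : 0 <= 1 - psi z by have /andP[_ ?] := psi01 z; rewrite subr_ge0.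
(* The two sides of [bayes_risk_ge_quadratic] at the averaged ratios; all terms are nonnegative, so
   they integrate term by term in the extended reals. *)
pose lhs z := 1 + \sum_i (eps^-1 * M^-1) * g i z.
pose rhs z := psi z + \sum_i M^-1 * (l i z * (1 - psi z)) +
  \sum_(u : I * I) ((2 * eps)^-1 * M^-2) * (g u.1 z * g u.2 z) + ((2 * eps)^-1 + eps / 2).
have lr z : lhs z <= rhs z.
  have := @bayes_risk_ge_quadratic R eps (psi z)
    (M^-1 * \sum_i l i z) (M^-1 * \sum_i g i z) eps0 (psi01 z).
  rewrite /lhs /rhs -!mulr_sumr -mulr_suml.
  have -> : \sum_(u : I * I) g u.1 z * g u.2 z = (\sum_i g i z) ^+ 2.
    rewrite expr2 mulr_suml -(pair_bigA _ (fun i j => g i z * g j z))/=.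
    by apply: eq_bigr => i _; rewrite mulr_sumr.
  have Mi : 0 <= M^-1 by rewrite invr_ge0 ltW.
  move=> /(_ _)/le_trans; rewrite ?mulrA; apply.
    apply/andP; split; first by rewrite mulr_ge0 ?sumr_ge0.
    by rewrite ler_wpM2l// ler_sum// => i _; have /andP[] := gl i z.
  by rewrite exprMn -exprVn mulrDr mulr1 !mulrA; lra.
have mgg (u : I * I) : measurable_fun setT (fun z => g u.1 z * g u.2 z).
  exact: measurable_funM.
have gg0 (u : I * I) z : 0 <= g u.1 z * g u.2 z by rewrite mulr_ge0.
have mlp i : measurable_fun setT (fun z => l i z * (1 - psi z)).
  by apply: measurable_funM => //; exact: measurable_funB.
have lp0 i z : 0 <= l i z * (1 - psi z) by rewrite mulr_ge0.
have c1 : 0 <= eps^-1 * M^-1 by rewrite mulr_ge0// invr_ge0 ltW.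
have c2 : 0 <= M^-1 by rewrite invr_ge0 ltW.
have c3 : 0 <= (2 * eps)^-1 * M^-2.
  by rewrite mulr_ge0// invr_ge0 ?exprn_ge0 ?mulr_ge0// ltW.
have c4 : 0 <= (2 * eps)^-1 + eps / 2.
  by rewrite addr_ge0// ?divr_ge0 ?invr_ge0 ?mulr_ge0// ltW.
have msum (J : finType) (c : R) (f : J -> Z -> R) :
    (forall j, measurable_fun setT (f j)) ->
    measurable_fun setT (fun z => \sum_j c * f j z).
  by move=> /= mf; apply: measurable_sum => j; apply: measurable_funM.
have sum0 (J : finType) (c : R) (f : J -> Z -> R) z : 0 <= c ->
    (forall j z, 0 <= f j z) -> 0 <= \sum_j c * f j z.
  by move=> c0 f0; apply: sumr_ge0 => j _; exact: mulr_ge0.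
have Icst (c : R) : (\int[P]_z c%:E = c%:E)%E.
  rewrite integral_cst// -[RHS]mule1; congr (_ * _)%E; exact: probability_setT.
have mlhs : measurable_fun setT lhs by apply: measurable_funD => //; exact: msum.
have mr1 : measurable_fun setT (fun z => \sum_i M^-1 * (l i z * (1 - psi z))).
  exact: msum.
have mr2 : measurable_fun setT
  (fun z => \sum_(u : I * I) ((2 * eps)^-1 * M^-2) * (g u.1 z * g u.2 z)) by exact: msum.
have r10 z : 0 <= \sum_i M^-1 * (l i z * (1 - psi z)).
  exact: (sum0 _ _ (fun i z => l i z * (1 - psi z))).
have r20 z : 0 <= \sum_(u : I * I) ((2 * eps)^-1 * M^-2) * (g u.1 z * g u.2 z).
  exact: (sum0 _ _ (fun (u : I * I) z => g u.1 z * g u.2 z)).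
have mrhs : measurable_fun setT rhs.
  by apply: measurable_funD => //; apply: measurable_funD => //; exact: measurable_funD.
have : (\int[P]_z (lhs z)%:E <= \int[P]_z (rhs z)%:E)%E.
  apply: ge0_le_integral => //.
  - by move=> z _; rewrite lee_fin addr_ge0// sum0.
  - exact/measurable_EFinP.
  - exact/measurable_EFinP.
  - by move=> z _; rewrite lee_fin.
have -> : (\int[P]_z (lhs z)%:E = 1 + \sum_i (eps^-1 * M^-1)%:E * \int[P]_z (g i z)%:E)%E.
  under eq_integral do rewrite EFinD.
  rewrite ge0_integralD//; last 2 first.
  - by move=> z _; rewrite lee_fin sum0.
  - by apply/measurable_EFinP; exact: msum.
  by rewrite ge0_integral_sum_EFinZ// Icst.
have -> : (\int[P]_z (rhs z)%:E = (e0 + \sum_i M^-1 * b i + ((2 * eps)^-1 + eps / 2))%:E +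
    \sum_(u : I * I) ((2 * eps)^-1 * M^-2)%:E * \int[P]_z (g u.1 z * g u.2 z)%:E)%E.
  under eq_integral do rewrite EFinD EFinD EFinD.
  rewrite ge0_integralD//; last 2 first.
  - by move=> z _; rewrite -!EFinD lee_fin !addr_ge0.
  - by apply/measurable_EFinP; apply: measurable_funD => //; exact: measurable_funD.
  rewrite ge0_integralD//; last 4 first.
  - by move=> z _; rewrite -!EFinD lee_fin !addr_ge0.
  - by apply/measurable_EFinP; exact: measurable_funD.
  - by move=> z _; rewrite lee_fin.
  - exact/measurable_EFinP.
  rewrite ge0_integralD//; last 4 first.
  - by move=> z _; rewrite lee_fin.
  - exact/measurable_EFinP.
  - by move=> z _; rewrite lee_fin.
  - exact/measurable_EFinP.
  rewrite e0E !ge0_integral_sum_EFinZ// Icst.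
  under [X in (_ + X + _ + _)%E]eq_bigr do rewrite bE -EFinM.
  by rewrite sumEFin -addeA [(\sum_u _ + _)%E]addeC addeA -!EFinD.
have lhs_ge : ((1 + eps^-1 * (1 - eta))%:E <=
    1 + \sum_i (eps^-1 * M^-1)%:E * \int[P]_z (g i z)%:E)%E.
  rewrite EFinD leeD2l//.
  have -> : ((eps^-1 * (1 - eta))%:E = \sum_(i : I) (eps^-1 * M^-1)%:E * (1 - eta)%:E)%E.
    under eq_bigr do rewrite -EFinM.
    rewrite sumEFin sumr_const cardT -cardE -mulr_natl -/M; congr EFin.
    by field; rewrite !gt_eqF.
  apply: lee_sum => i _; rewrite lee_wpmul2l// EFinB leeBlDr//.
have rhs_le : (\sum_(u : I * I)
      ((2 * eps)^-1 * M^-2)%:E * \int[P]_z (g u.1 z * g u.2 z)%:E <=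
    ((2 * eps)^-1 * W)%:E)%E.
  apply: (@le_trans _ _ (\sum_(u : I * I) ((2 * eps)^-1 * M^-2 * v u.1 u.2)%:E)%E).
    by apply: lee_sum => u _; rewrite [leRHS]EFinM lee_wpmul2l// lee_fin.
  rewrite sumEFin lee_fin -mulr_sumr -(pair_bigA _ (fun i j => v i j))/=.
  apply: le_trans (ler_wpM2l c3 vW) _; rewrite -/M le_eqVlt; apply/orP; left; apply/eqP.
  by field; rewrite !gt_eqF.
move=> /(le_trans lhs_ge) /le_trans /(_ (leeD2l _ rhs_le)).
rewrite -EFinD lee_fin -mulr_sumr -/M => h.
have -> : (W - 1 + 2 * eta) / (2 * eps) = (2 * eps)^-1 * W - (2 * eps)^-1 + eps^-1 * eta.
  by field; rewrite gt_eqF.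
have e2 : eps^-1 = 2 * (2 * eps)^-1 by field; rewrite gt_eqF.
have h2 : eps^-1 * (1 - eta) = 2 * (2 * eps)^-1 - eps^-1 * eta.
  by rewrite mulrBr mulr1 {1}e2.
move: h; rewrite h2.
lra.
Qed.

(** * The block prior *)

Section block_prior.
Variables (K b p : nat).
Hypothesis Kbp : (K * b <= p)%N.

Lemma block_index_subproof (u : 'I_K * 'I_b) : (u.1 * b + u.2 < p)%N.
Proof.
apply: leq_trans Kbp; apply: (@leq_trans (u.1 * b + b)%N).
  by rewrite ltn_add2l.
by rewrite -mulSnr leq_mul2r ltn_ord orbT.
Qed.

Definition block_index u : 'I_p := Ordinal (block_index_subproof u).

Lemma block_index_inj : injective block_index.
Proof.
move=> [i c] [j e] /(congr1 val) /= h.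
have b0 : (0 < b)%N by exact: (leq_ltn_trans (leq0n c) (ltn_ord c)).
have ij : i = j :> nat.
  have := congr1 (fun m => m %/ b)%N h.
  by rewrite !divnMDl// !divn_small ?addn0 ?ltn_ord.
have ce : c = e :> nat by move: h; rewrite ij => /addnI.
by congr (_, _); exact: val_inj.
Qed.

(* One active coordinate in each of K blocks of length b: the size of the overlap
   of two such supports is a sum of K independent Bernoulli(1 / b) variables. *)
Definition block_support (f : {ffun 'I_K -> 'I_b}) : 'I_p -> bool :=
  fun j => [exists i, j == block_index (i, f i)].

Lemma sum_block_support f : (\sum_(j < p) block_support f j = K)%N.
Proof.
have inj : injective (fun i => block_index (i, f i)).
  by move=> i j /block_index_inj [].
rewrite -[RHS](card_ord K) -(card_codom inj) -sum1_card [RHS]big_mkcond /=.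
apply: eq_bigr => j _; rewrite /block_support.
suff -> : (j \in codom (fun i => block_index (i, f i))) =
  [exists i, j == block_index (i, f i)] by case: [exists _, _].
by apply/codomP/existsP => -[i h]; exists i; apply/eqP.
Qed.

(** The blocks are disjoint, so within block i the supports meet exactly when [f] and [g] make the
    same choice. *)
Lemma sum_block_support_overlap f g :
  (\sum_(j < p) (block_support f j && block_support g j) = \sum_(i < K) (f i == g i))%N.
Proof.
have inj : injective (fun i => block_index (i, f i)).
  by move=> i j /block_index_inj [].
rewrite (eq_bigr (fun j => \sum_(i < K) ((j == block_index (i, f i)) && (f i == g i)))%N).
  rewrite exchange_big; apply: eq_bigr => i _ /=.
  by rewrite (bigD1 (block_index (i, f i)))//= eqxx big1 ?addn0// => j /negbTE ->.
move=> j _; have [/andP[/existsP[i /eqP ji] /existsP[i' /eqP ji']]|nh] := boolP (_ && _).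
  have [ii' fg] : i = i' /\ f i = g i'.
    by have /block_index_inj[] := etrans (esym ji) ji'.
  have fgi : f i == g i by rewrite fg ii'.
  rewrite (bigD1 i)//= {1}ji eqxx fgi big1// => k ki.
  suff /negbTE -> : j != block_index (k, f k) by [].
  by apply: contra_neq ki; rewrite ji => /inj ->.
rewrite big1// => i _; case: eqVneq => //= ji; case: eqVneq => //= fg.
case/negP: nh; rewrite ji; apply/andP; split; apply/existsP; exists i => //.
by rewrite fg.
Qed.

(** For fixed [f] the sum over [g] factors over blocks, each giving q once and 1 for the other b - 1
    choices. The average is (1 + (q - 1) / b)^K, at most exp (K q / b). *)
Lemma sum_exp_overlap (R : realType) (q : R) : (0 < b)%N -> 0 <= q ->
  \sum_(f : {ffun 'I_K -> 'I_b}) \sum_(g : {ffun 'I_K -> 'I_b})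
    q ^+ (\sum_(i < K) (f i == g i))%N <=
  #|{ffun 'I_K -> 'I_b}|%:R ^+ 2 * expR (K%:R * q / b%:R).
Proof.
move=> b0 q0.
have inner f : \sum_(g : {ffun 'I_K -> 'I_b}) q ^+ (\sum_(i < K) (f i == g i))%N =
    (b%:R - 1 + q) ^+ K.
  under eq_bigr do rewrite expr_sum.
  rewrite -(bigA_distr_bigA (fun i c => q ^+ (f i == c))).
  rewrite -[K in RHS]card_ord -prodr_const.
  apply: eq_bigr => i _; rewrite (bigD1 (f i))//= eqxx expr1 addrC; congr (_ + _).
  rewrite (eq_bigr (fun=> 1)) => [|c /negbTE h]; last by rewrite eq_sym h expr0.
  rewrite sumr_const (_ : #|_| = b.-1); last first.
    by have := cardC1 (f i); rewrite card_ord => <-; exact: eq_card.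
  by rewrite -[b in RHS]prednK// -natr1 addrK.
under eq_bigr do rewrite inner.
rewrite sumr_const cardT -cardE -[X in X <= _]mulr_natl card_ffun !card_ord.
have bR : 0 < b%:R :> R by rewrite ltr0n.
have -> : b%:R - 1 + q = b%:R * (1 + (q - 1) / b%:R) by field; rewrite gt_eqF.
rewrite exprMn natrX mulrA -expr2 ler_wpM2l ?exprn_ge0//.
rewrite -mulrA expRM_natl.
apply: (@lerXn2r _ K) => //; rewrite ?nnegrE ?expR_ge0//.
  have -> : 1 + (q - 1) / b%:R = (b%:R - 1 + q) / b%:R by field; rewrite gt_eqF.
  by apply: divr_ge0 => //; apply: addr_ge0 => //; rewrite subr_ge0 ler1n.
apply: le_trans (expR_ge1Dx _); rewrite lerD2l ler_wpM2r ?invr_ge0 ?(ltW bR)//.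
by rewrite gerBl.
Qed.

End block_prior.

(** * Lower bound on the minimax risk for fixed n and p *)

Section gamma_lower_bound.
Variable R : realType.

Lemma gamma_un_ge (n p : nat) (k r c : R) :
  (forall psi : data R n p -> R, is_test psi ->
    (c%:E <= alpha_un psi + beta_un psi (sparse_set k r))%E) ->
  (c%:E <= gamma_un n p k r)%E.
Proof. by move=> h; apply/ereal_infP => _ [psi tpsi <-]; exact: h. Qed.

Lemma alpha_un_ge (n p : nat) (psi : data R n p -> R) :
  (\int[gaussian_law n (0 : 'rV_p) 1]_z (psi z)%:E <= alpha_un psi)%E.
Proof.
by apply: ereal_sup_ubound; exists 1 => /=; rewrite ?ltr01// unlock.
Qed.

Lemma beta_un_ge (n p : nat) (psi : data R n p -> R) (Theta : set 'rV[R]_p)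
    (theta : 'rV[R]_p) (s : R) : 0 < s -> Theta theta ->
  (\int[gaussian_law n (s *: theta) s]_z (1 - psi z)%:E <= beta_un psi Theta)%E.
Proof.
move=> s0 th; apply: ereal_sup_ubound; exists theta => //; exists s => //.
by rewrite unlock.
Qed.

Lemma sparse_set_support_vector (p K : nat) (a k r : R) (S : 'I_p -> bool) :
  0 <= a -> (\sum_(j < p) S j = K)%N -> K%:R <= k -> r <= a * Num.sqrt K%:R ->
  sparse_set k r (support_vector a S).
Proof.
move=> a0 cS Kk ra; split => /=.
  apply: le_trans Kk; rewrite ler_nat -cS /card_support -sum1_card big_mkcond/=.
  apply: leq_sum => j _; rewrite inE mxE; case: (S j).
  by case: (_ != _).
  by rewrite mulr0 eqxx.
apply: le_trans ra _; rewrite /euclidean_norm le_eqVlt; apply/orP; left; apply/eqP.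
have sq (c : bool) : (c%:R : R) ^+ 2 = c%:R by case: c; rewrite ?expr1n ?expr0n.
under eq_bigr => j _ do rewrite mxE exprMn sq.
by rewrite -mulr_sumr -natr_sum cS sqrtrM ?sqr_ge0// sqrtr_sqr ger0_norm.
Qed.

(** [l] serves the second moment, [m] the truncation loss [eta], and [q] bounds the weight of one
    common coordinate. The radius is divided by the noise level because [beta_un] rescales theta by
    sigma. *)
Lemma gamma_un_lb (n p K b : nat) (k r a l m T q eps : R) :
  let D o : R := (1 - a ^+ 2 * o) ^+ 2 + 4 * a * l * o * (1 - a ^+ 2 * o)
     - l ^+ 2 * o * (1 - a ^+ 2 * o) ^+ 2 in
  let E : R := 1 - 2 * m * a - m ^+ 2 * (1 - a ^+ 2) in
  let eta := K%:R * (expR (- m * T) * (Num.sqrt E)^-1 ^+ n) in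
  (0 < b)%N -> (K * b <= p)%N -> K%:R <= k ->
  0 <= a -> a ^+ 2 * K%:R < 1 ->
  r <= a * Num.sqrt K%:R / Num.sqrt (1 - a ^+ 2 * K%:R) ->
  0 <= l -> 0 <= m -> 0 <= q -> 0 < eps ->
  (forall o : nat, (o <= K)%N -> 0 < D o%:R) ->
  (forall o : nat, (o <= K)%N ->
    expR (l * T * o%:R) * (Num.sqrt (D o%:R))^-1 ^+ n <= q ^+ o) ->
  0 < E ->
  ((1 - eps / 2 - (expR (K%:R * q / b%:R) - 1 + 2 * eta) / (2 * eps))%:E <=
   gamma_un n p k r)%E.
Proof.
move=> D E eta b0 Kbp Kk a0 aK ra l0 m0 q0 eps0 D0 Dq E0.
apply: gamma_un_ge => psi [mpsi psi01].
pose s := Num.sqrt (1 - a ^+ 2 * K%:R).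
have s0 : 0 < s by rewrite sqrtr_gt0 subr_gt0.
have s2 : s ^+ 2 = 1 - a ^+ 2 * K%:R by rewrite sqr_sqrtr// subr_ge0 ltW.
pose N := normal_law (0 : R) 1.
pose P0 := (iid (iid N p) n \x iid N n)%E.
pose I : finType := {ffun 'I_K -> 'I_b}.
pose S (f : I) := block_support Kbp f.
have cS f : (\sum_(j < p) S f j = K)%N by exact: sum_block_support.
pose L (f : I) := @lr R n p a s (S f).
pose G (f : I) z := L f z * trunc T (S f) z.
have mL f : measurable_fun setT (L f) by exact: measurable_lr.
have mG f : measurable_fun setT (G f).
  by apply: measurable_funM => //; exact: measurable_trunc.
have L0 f z : 0 <= L f z by exact: lr_ge0.
have psi0 z : 0 <= psi z by have /andP[] := psi01 z.
have psi1 z : 0 <= 1 - psi z by have /andP[_ ?] := psi01 z; rewrite subr_ge0.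
have mpsi1 : measurable_fun setT (fun z => 1 - psi z) by exact: measurable_funB.
have mLp f : measurable_fun setT (fun z => L f z * (1 - psi z)) by exact: measurable_funM.
have GL f z : 0 <= G f z <= L f z.
  rewrite mulr_ge0 ?trunc_ge0//=.
  by rewrite ler_piMr ?trunc_le1.
have fin_psi : (\int[P0]_z (psi z)%:E)%E \is a fin_num.
  rewrite ge0_fin_numE; last by apply: integral_ge0 => z _; rewrite lee_fin.
  apply: (@le_lt_trans _ _ (\int[P0]_z 1)%E); last first.
    rewrite integral_cst// mul1e; apply: (@le_lt_trans _ _ 1%E); last exact: ltry.
    exact: probability_le1.
  apply: ge0_le_integral => //; first by move=> z _; rewrite lee_fin.
    exact/measurable_EFinP.
  by move=> z _; rewrite lee_fin; have /andP[] := psi01 z.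
have fin_L f : (\int[P0]_z (L f z * (1 - psi z))%:E)%E \is a fin_num.
  rewrite ge0_fin_numE; last by apply: integral_ge0 => z _; rewrite lee_fin mulr_ge0.
  apply: (@le_lt_trans _ _ (\int[P0]_z (L f z)%:E)%E); last by rewrite integral_lr// ltry.
  apply: ge0_le_integral => //; first by move=> z _; rewrite lee_fin mulr_ge0.
  - exact/measurable_EFinP.
  - exact/measurable_EFinP.
  - by move=> z _; rewrite lee_fin ler_piMr// gerBl.
pose e0 := fine (\int[P0]_z (psi z)%:E)%E.
pose B f := fine (\int[P0]_z (L f z * (1 - psi z))%:E)%E.
pose i0 : I := [ffun=> Ordinal b0].
have alpha : (e0%:E <= alpha_un psi)%E.
  rewrite fineK//; apply: le_trans (alpha_un_ge psi).
  by rewrite integral_gaussian_law0//; exact/measurable_EFinP.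
have beta f : ((B f)%:E <= beta_un psi (sparse_set k r))%E.
  rewrite fineK//.
  have Sf : sparse_set k r (support_vector (a / s) (S f)).
    apply: (sparse_set_support_vector _ (cS f) Kk); first by rewrite divr_ge0// ltW.
    by rewrite mulrAC.
  apply: le_trans (beta_un_ge psi s0 Sf).
  have -> : s *: support_vector (a / s) (S f) = support_vector a (S f).
    by apply/rowP => j; rewrite !mxE mulrA mulrCA mulfV ?mulr1// gt_eqF.
  rewrite (integral_gaussian_law_lr a s0); last 2 first.
  - exact/measurable_EFinP.
  - by move=> z; rewrite lee_fin.
  by under [leRHS]eq_integral do rewrite -EFinM.
(* The supremum over alternatives dominates the Bayes average, through the worst support [f1]. *)
have [f1 f1P] : exists f1, #|I|%:R^-1 * \sum_f B f <= B f1.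
  case: (@arg_maxP _ _ _ i0 predT B isT) => f1 _ f1P; exists f1.
  rewrite ler_pdivrMl ?ltr0n; last by apply/card_gt0P; exists i0.
  rewrite mulr_natl -sumr_const; apply: ler_sum => f _; exact: f1P.
apply: le_trans (leeD alpha (beta f1)); rewrite -EFinD lee_fin.
apply: (@le_trans _ _ (e0 + #|I|%:R^-1 * \sum_f B f)); last by rewrite lerD2l.
apply: (@mixture_second_moment _ _ R P0 I i0 psi L G eps eta _ e0 B
  (fun f g => q ^+ (\sum_(i < K) (f i == g i))%N)) => //.
- by rewrite fineK.
- by move=> f; rewrite fineK.
- by move=> f; exact: (integral_lr_trunc n s0 T m0 s2 (cS f) E0).
- move=> f g.
  have oK : (\sum_(i < K) (f i == g i) <= K)%N.
    rewrite -[leqRHS]card_ord -sum1_card; apply: leq_sum => i _.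
    by case: (_ == _).
  have oE : (\sum_(j < p) (S f j && S g j))%N = (\sum_(i < K) (f i == g i))%N.
    exact: sum_block_support_overlap.
  have := @integral_lr2_trunc R n p a s s0 T K (S f) (S g) l l0 s2 (cS f) (cS g).
  rewrite /= oE => /(_ (D0 _ oK))/le_trans; apply.
  by rewrite lee_fin; exact: Dq.
- exact: sum_exp_overlap.
Qed.

End gamma_lower_bound.

(** * Elementary asymptotics *)

Section asymptotics.
Variable R : realType.

(** The test that never rejects has no type I error. *)
Lemma gamma_un_le1 (n p : nat) (k r : R) : (gamma_un n p k r <= 1)%E.
Proof.
apply: (@le_trans _ _ (alpha_un (fun _ : data R n p => 0%R) +
  beta_un (fun _ : data R n p => 0%R) (@sparse_set R p k r))%E).
  apply: ereal_inf_lbound; exists (fun=> 0) => //; split; first exact: measurable_cst.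
  by move=> z; rewrite lexx ler01.
rewrite -[leRHS]add0e; apply: leeD; apply: ge_ereal_sup.
  by move=> _ [s _ <-]; rewrite expectation_cst.
move=> _ [th _ [s _ <-]].
rewrite unlock /=; under eq_integral do rewrite subr0.
by rewrite integral_cst// mul1e; exact: probability_le1.
Qed.

Lemma gamma_un_cvg1 (n p : nat -> nat) (k r : nat -> R) :
  (forall e : R, 0 < e -> \forall m \near \oo,
     ((1 - e)%:E <= gamma_un (n m) (p m) (k m) (r m))%E) ->
  gamma_un (n m) (p m) (k m) (r m) @[m --> \oo] --> (1 : \bar R)%E.
Proof.
move=> h; apply/fine_cvgP; split.
  near=> m.
  have lo : ((1 - 1)%:E <= gamma_un (n m) (p m) (k m) (r m))%E by near: m; exact: h.
  rewrite fin_numE; apply/andP; split; apply/eqP => g; first by rewrite g in lo.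
  by have := gamma_un_le1 (n m) (p m) (k m) (r m); rewrite g.
apply/cvgrPdist_le => e e0; near=> m.
have : ((1 - e)%:E <= gamma_un (n m) (p m) (k m) (r m))%E by near: m; exact: h.
have := gamma_un_le1 (n m) (p m) (k m) (r m); rewrite /=.
case: (gamma_un _ _ _ _) => [g| |]//=; rewrite !lee_fin => g1 ge.
rewrite ger0_norm; lra.
Unshelve. all: by end_near. Qed.

Lemma expRN_le_quadratic (y : R) : - (1 / 2) <= y -> expR (- y) <= 1 - y + 2 * y ^+ 2.
Proof.
move=> y0; have y1 : 0 < 1 + y by lra.
rewrite expRN; apply: (@le_trans _ _ (1 + y)^-1).
  by rewrite lef_pV2 ?posrE ?expR_gt0// expR_ge1Dx.
rewrite -[leLHS]mul1r ler_pdivrMr//.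
have : 0 <= y ^+ 2 * (1 + 2 * y) by rewrite mulr_ge0 ?sqr_ge0//; lra.
rewrite expr2; lra.
Qed.

(** The slack [delta] in the slope absorbs the quadratic remainder near 0. Exponential bounds are
    wanted because they pass exactly to n-th powers. *)
Lemma expR_le_near0 (G : R -> R) (g C delta : R) : 0 <= C -> 0 < delta ->
  (forall u, 0 <= u <= 1 -> 1 - g * u - C * u ^+ 2 <= G u) ->
  exists2 kappa, 0 < kappa &
    forall u, 0 <= u <= kappa -> expR (- ((g + delta) * u)) <= G u.
Proof.
move=> C0 d0 GC; pose h := g + delta.
have n0 : 0 < 2 * (`|h| + 1) by rewrite mulr_gt0// ltr_wpDl.
have q0 : 0 < 2 * h ^+ 2 + C + 1 by rewrite ltr_wpDl// addr_ge0// mulr_ge0// sqr_ge0.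
(* In order: the domain of [GC]; |h| u <= 1/2 for [expRN_le_quadratic]; (2 h^2 + C) u <= delta. *)
exists (Num.min 1 (Num.min (2 * (`|h| + 1))^-1 (delta / (2 * h ^+ 2 + C + 1)))).
  by rewrite !lt_min ltr01 invr_gt0 n0 divr_gt0.
move=> u; rewrite !le_min => /and4P[u0 u1 un uq].
apply: le_trans (GC u _); last by rewrite u0.
have hn : `|h| * u <= 1 / 2.
  have : u * (2 * (`|h| + 1)) <= 1 by rewrite -ler_pdivlMr// mul1r.
  have : 0 <= `|h| * u by rewrite mulr_ge0.
  lra.
have hu : - (`|h| * u) <= h * u by rewrite -mulNr ler_wpM2r// lerNl ler_normr lexx orbT.
apply: le_trans (expRN_le_quadratic _) _; first by rewrite -/h; lra.
rewrite -/h.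
have uq' : u * (u * (2 * h ^+ 2 + C + 1)) <= u * delta.
  by rewrite ler_wpM2l// -ler_pdivlMr.
have : 0 <= u ^+ 2 by exact: sqr_ge0.
rewrite exprMn !expr2 /h in uq' *; nra.
Qed.

(* [t0] is the truncation level and [l0] the Chernoff exponent, both in units of
   sqrt(ln p / n). For beta <= 3/4 the truncation is not needed and [l0 = 0];
   otherwise the optimal choice is t0 = sqrt 2 and l0 = 2 x1 - sqrt 2. *)
Lemma detection_parameters (beta x0 : R) : 1 / 2 < beta -> beta < 1 -> x0 < phi beta ->
  exists x1 l0 t0 : R, [/\ x0 < x1, 0 < x1, 0 <= l0 & x1 < t0] /\
    x1 ^+ 2 - 2 * x1 * l0 + l0 ^+ 2 / 2 + l0 * t0 < 2 * beta - 1 /\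
    1 - beta < (t0 - x1) ^+ 2 / 2.
Proof.
move=> b0 b1; rewrite /phi; case: ifPn => [b3 xphi|].
  have phi0 : 0 < Num.sqrt (2 * beta - 1) by rewrite sqrtr_gt0; lra.
  pose M := Num.max x0 0.
  have M1 : M < Num.sqrt (2 * beta - 1) by rewrite gt_max xphi.
  have Mx : x0 <= M by rewrite le_max lexx.
  have M0 : 0 <= M by rewrite le_max lexx orbT.
  pose x1 := (M + Num.sqrt (2 * beta - 1)) / 2.
  (* With l0 = 0 the level only has to satisfy 1 - beta < (t0 - x1)^2 / 2, whose right side is 2
     here. *)
  exists x1, 0, (x1 + 2); split; first by split; rewrite /x1; lra.
  split; last by rewrite [x1 + 2]addrC addrK; lra.
  rewrite mulr0 mul0r expr0n mul0r subr0 !addr0.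
  have : x1 ^+ 2 < Num.sqrt (2 * beta - 1) ^+ 2.
    by rewrite ltr_pXn2r ?nnegrE//; rewrite /x1; lra.
  by rewrite sqr_sqrtr; lra.
rewrite -ltNge => b3.
set y := Num.sqrt 2; set s := Num.sqrt (1 - beta) => xphi.
have y2 : y ^+ 2 = 2 by rewrite sqr_sqrtr.
have s2 : s ^+ 2 = 1 - beta by rewrite sqr_sqrtr//; lra.
have y0 : 0 < y by rewrite sqrtr_gt0.
have s0 : 0 <= s by exact: sqrtr_ge0.
have s12 : s < 1 / 2.
  by rewrite -(ltr_pXn2r (n := 2)) ?nnegrE//; rewrite s2; lra.
have ys : y * s < y / 2 by rewrite -[y / 2]/(y * 2^-1) ltr_pM2l//; lra.
(* The floor y / 2 makes l0 = 2 x1 - y positive; it lies below y (1 - s) because beta > 3/4. *)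
pose M := Num.max x0 (y / 2).
have M1 : M < y * (1 - s) by rewrite gt_max xphi/=; lra.
have Mx : x0 <= M by rewrite le_max lexx.
have M0 : y / 2 <= M by rewrite le_max lexx orbT.
pose x1 := (M + y * (1 - s)) / 2.
have x1l : y / 2 < x1 by rewrite /x1; lra.
have x1u : y * s < y - x1 by rewrite /x1; lra.
have h : y ^+ 2 * s ^+ 2 < (y - x1) ^+ 2.
  rewrite -exprMn ltr_pXn2r ?nnegrE ?mulr_ge0 ?(ltW y0)//.
  by have := mulr_ge0 (ltW y0) s0; lra.
exists x1, (2 * x1 - y), y; split.
  by split; rewrite /x1; have := mulr_ge0 (ltW y0) s0; lra.
rewrite y2 s2 in h; split; last lra.
have -> : x1 ^+ 2 - 2 * x1 * (2 * x1 - y) + (2 * x1 - y) ^+ 2 / 2 + (2 * x1 - y) * y =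
  y ^+ 2 / 2 - (y - x1) ^+ 2 by field.
by rewrite y2; lra.
Qed.

End asymptotics.

(** * Lower bounds along the sparsity p^(1 - beta) *)

Section boundary.
Variables (R : realType) (beta : R).
Hypotheses (beta_gt : 1 / 2 < beta) (beta_lt : beta < 1).

Lemma sparsity_exp (p : nat) : (0 < p)%N -> sparsity beta p = expR ((1 - beta) * ln p%:R).
Proof. by move=> p0; rewrite /sparsity /powR gt_eqF// ltr0n. Qed.

Lemma sparsity_ge1 (p : nat) : (0 < p)%N -> 1 <= sparsity beta p.
Proof.
move=> p0; rewrite sparsity_exp// -[leLHS]expR0 ler_expR.
by rewrite mulr_ge0 ?ln_ge0 ?ler1n ?subr_ge0 ?(ltW beta_lt).
Qed.

(** p < (b + 1) K <= 2 b K since b >= 1: cutting p into whole blocks loses at most a factor 2. *)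
Lemma prior_sizes (p : nat) : (0 < p)%N ->
  let K := Num.truncn (sparsity beta p) in let b := (p %/ K)%N in
  [/\ (0 < K)%N, (0 < b)%N & (K * b <= p)%N] /\
  [/\ K%:R <= sparsity beta p, sparsity beta p < K%:R + 1
    & p%:R <= 2 * (K%:R * b%:R) :> R].
Proof.
move=> p0 K b; have k1 := sparsity_ge1 p0.
have k0 : 0 <= sparsity beta p by exact: le_trans ler01 k1.
have K0 : (0 < K)%N by rewrite truncn_gt0.
have /andP[Kk kK] := truncn_itv k0.
have kp : sparsity beta p <= p%:R.
  rewrite sparsity_exp// -[leRHS]lnK ?posrE ?ltr0n// ler_expR.
  by apply: ler_piMl; [rewrite ln_ge0 ?ler1n|have := beta_gt; lra].
have Kp : (K <= p)%N by rewrite -(ler_nat R); exact: le_trans kp.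
have b0 : (0 < b)%N by rewrite divn_gt0.
split; split => //; first by rewrite mulnC leq_trunc_div.
  by rewrite natr1.
rewrite -natrM -[2]/(2%:R) -natrM ler_nat; apply: ltnW.
apply: leq_trans (ltn_ceil p K0) _.
rewrite -/b (mulnC K) mulnA leq_mul2r mul2n -addnn -addn1 leq_add2l b0.
by rewrite orbT.
Qed.

(* For c < 2 beta - 1 this makes the overlap of two random supports negligible,
   even when each common coordinate is weighted by p^c. *)
Lemma prior_ratio_le (p : nat) (c : R) : (0 < p)%N ->
  let K := Num.truncn (sparsity beta p) in let b := (p %/ K)%N in
  K%:R * expR (c * ln p%:R) / b%:R <= 2 * expR (- ((2 * beta - 1 - c) * ln p%:R)).
Proof.
move=> p0; cbv zeta; set K := Num.truncn _; set b := (p %/ K)%N.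
have [[K0 b0 _] [Kk _ pKb]] := prior_sizes p0; rewrite -/K -/b in K0 b0 Kk pKb.
rewrite ler_pdivrMr ?ltr0n//.
have pE : expR (ln p%:R) = p%:R :> R by rewrite lnK// posrE ltr0n.
have KR : 0 < K%:R :> R by rewrite ltr0n.
have k2 : K%:R ^+ 2 <= expR (2 * (1 - beta) * ln p%:R).
  rewrite -mulrA expRM_natl -sparsity_exp// lerXn2r ?nnegrE//.
  exact: le_trans Kk.
(* Multiplying by K brings out K^2 <= p^(2 (1 - beta)) on the left and 2 K b >= p on the right. *)
rewrite -(ler_pM2l KR) mulrA -expr2.
apply: (@le_trans _ _ (expR (2 * (1 - beta) * ln p%:R) * expR (c * ln p%:R))).
  by rewrite ler_wpM2r// expR_ge0.
have -> : K%:R * (2 * expR (- ((2 * beta - 1 - c) * ln p%:R)) * b%:R) =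
    expR (- ((2 * beta - 1 - c) * ln p%:R)) * (2 * (K%:R * b%:R)) by ring.
apply: (@le_trans _ _ (expR (- ((2 * beta - 1 - c) * ln p%:R)) * p%:R)).
  rewrite -pE -!expRD le_eqVlt; apply/orP; left; apply/eqP; rewrite expRK.
  by congr expR; ring.
by rewrite ler_wpM2l// expR_ge0.
Qed.

(** Here q = p^c and eps = e. The last two bounds make the overlap factor at most 1 + e^2 / 2 and 2
    eta at most e^2 / 2, so the quotient is at most e / 2 and the total loss at most e. *)
Lemma gamma_un_lb_sparsity (n p : nat) (r a l m T c e : R) :
  let K := Num.truncn (sparsity beta p) in
  let D o : R := (1 - a ^+ 2 * o) ^+ 2 + 4 * a * l * o * (1 - a ^+ 2 * o)
     - l ^+ 2 * o * (1 - a ^+ 2 * o) ^+ 2 in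
  let E : R := 1 - 2 * m * a - m ^+ 2 * (1 - a ^+ 2) in
  (0 < p)%N -> 0 <= a -> a ^+ 2 * K%:R < 1 ->
  r <= a * Num.sqrt K%:R / Num.sqrt (1 - a ^+ 2 * K%:R) ->
  0 <= l -> 0 <= m -> 0 < e ->
  (forall o : nat, (o <= K)%N -> 0 < D o%:R) ->
  (forall o : nat, (o <= K)%N ->
    expR (l * T * o%:R) * (Num.sqrt (D o%:R))^-1 ^+ n <= expR (c * ln p%:R * o%:R)) ->
  0 < E ->
  K%:R * (expR (- m * T) * (Num.sqrt E)^-1 ^+ n) <= e ^+ 2 / 4 ->
  2 * expR (- ((2 * beta - 1 - c) * ln p%:R)) <= ln (1 + e ^+ 2 / 2) ->
  ((1 - e)%:E <= gamma_un n p (sparsity beta p) r)%E.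
Proof.
move=> K D E p0 a0 aK ra l0 m0 e0 D0 Dq E0 etae qe.
have [[K0 b0 Kb] [Kk _ _]] := prior_sizes p0.
have Dq' o : (o <= K)%N ->
    expR (l * T * o%:R) * (Num.sqrt (D o%:R))^-1 ^+ n <= expR (c * ln p%:R) ^+ o.
  by move=> oK; rewrite -expRM_natr; exact: Dq.
have := gamma_un_lb b0 Kb Kk a0 aK ra l0 m0 (expR_ge0 _) e0 D0 Dq' E0.
apply: le_trans; rewrite lee_fin.
have h : expR (K%:R * expR (c * ln p%:R) / (p %/ K)%:R) <= 1 + e ^+ 2 / 2.
  have e2 : 0 < 1 + e ^+ 2 / 2 by rewrite ltr_pwDl// divr_ge0// sqr_ge0.
  rewrite -[leRHS]lnK ?posrE// ler_expR; apply: le_trans qe.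
  exact: prior_ratio_le.
set W := expR _ in h *; set eta := _ * (_ * _) in etae *.
have : (W - 1 + 2 * eta) / (2 * e) <= e / 2.
  rewrite ler_pdivrMr ?mulr_gt0//.
  have -> : e / 2 * (2 * e) = e ^+ 2 by field.
  lra.
lra.
Qed.

(** With l = 0 a row contributes (1 - w)^-1 <= exp (w / (1 - w)), w = a^2 o, and w / (1 - w) <= o
    r^2 / K. The n-th power is at most p^(c o); the factor 2 in the assumption on n pays for
    replacing p^(1 - beta) by K. *)
Lemma gamma_un_lb_dense (n p : nat) (r e : R) :
  let c := (2 * beta - 1) / 2 in
  (0 < p)%N -> 0 < r -> 0 < e ->
  2 * r ^+ 2 * n%:R <= c * (sparsity beta p * ln p%:R) ->
  2 * expR (- (c * ln p%:R)) <= ln (1 + e ^+ 2 / 2) ->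
  ((1 - e)%:E <= gamma_un n p (sparsity beta p) r)%E.
Proof.
move=> c p0 r0 e0 nr qe.
set K := Num.truncn (sparsity beta p).
have [[K0 b0 Kb] [Kk kK _]] := prior_sizes p0; rewrite -/K in K0 Kk kK Kb.
have L0 : 0 <= ln p%:R :> R by rewrite ln_ge0// ler1n.
have c0 : 0 < c by rewrite /c; have := beta_gt; lra.
have KR : 0 < K%:R :> R by rewrite ltr0n.
have K1 : 1 <= K%:R :> R by rewrite ler1n.
have r20 : 0 < r ^+ 2 by rewrite exprn_gt0.
have r21 : 0 < 1 + r ^+ 2 by rewrite ltr_pwDl// ltW.
(* The noise variance becomes 1 / (1 + r^2) and the radius exactly r. *)
pose a := r / Num.sqrt (1 + r ^+ 2) / Num.sqrt K%:R.
have a2 : a ^+ 2 = r ^+ 2 / (1 + r ^+ 2) / K%:R.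
  by rewrite !exprMn !exprVn !sqr_sqrtr// ltW.
have aK : a ^+ 2 * K%:R = r ^+ 2 / (1 + r ^+ 2) by rewrite a2 divfK// gt_eqF.
have a0 : 0 < a by rewrite !divr_gt0// sqrtr_gt0.
have aK1 : 1 - a ^+ 2 * K%:R = (1 + r ^+ 2)^-1 by rewrite aK; field; rewrite gt_eqF.
have aK2 : a ^+ 2 * K%:R < 1 by rewrite -subr_gt0 aK1 invr_gt0.
have a21 : a ^+ 2 < 1.
  by apply: le_lt_trans aK2; rewrite ler_peMr// exprn_ge0// ltW.
have a1 : a < 1 by rewrite -(ltr_pXn2r (n := 2)) ?nnegrE ?expr1n// ltW.
have nK : n%:R * r ^+ 2 <= c * ln p%:R * K%:R.
  have : c * ln p%:R * sparsity beta p <= c * ln p%:R * (2 * K%:R).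
    by apply: ler_wpM2l; [exact: mulr_ge0 (ltW c0) L0|lra].
  lra.
(* The exponent m = 1/4 keeps [E] positive for every a in (0, 1). *)
pose E : R := 1 - 2 * 4^-1 * a - 4^-1 ^+ 2 * (1 - a ^+ 2).
have E0 : 0 < E.
  have : 0 <= a ^+ 2 by exact: sqr_ge0.
  by rewrite /E !expr2; lra.
(* The truncation level is solved from X exp (- T / 4) = e^2 / 4. *)
pose X := K%:R * (Num.sqrt E)^-1 ^+ n.
have X0 : 0 < X by rewrite mulr_gt0// exprn_gt0// invr_gt0 sqrtr_gt0.
have eX : 0 < e ^+ 2 / 4 / X by rewrite !divr_gt0// exprn_gt0.
have w1 (o : nat) : (o <= K)%N -> 0 < 1 - a ^+ 2 * o%:R.
  move=> oK; rewrite subr_gt0; apply: le_lt_trans aK2.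
  by rewrite ler_wpM2l ?sqr_ge0// ler_nat.
have DE o : (1 - a ^+ 2 * o) ^+ 2 + 4 * a * 0 * o * (1 - a ^+ 2 * o)
     - 0 ^+ 2 * o * (1 - a ^+ 2 * o) ^+ 2 = (1 - a ^+ 2 * o) ^+ 2 by ring.
(* As l = 0, the truncation level is only constrained from below. *)
apply: (@gamma_un_lb_sparsity n p r a 0 4^-1 (- 4 * ln (e ^+ 2 / 4 / X)) c e) => //.
- exact: ltW.
- rewrite aK1 sqrtrV ?(ltW r21)// invrK /a divfK ?divfK// gt_eqF// sqrtr_gt0//.
- by move=> o /w1 h; rewrite DE exprn_gt0.
- move=> o oK; rewrite DE sqrtr_sqr gtr0_norm ?w1// !mul0r expR0 mul1r.
  pose w := a ^+ 2 * o%:R.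
  have w0 : 0 <= w by rewrite mulr_ge0// sqr_ge0.
  have wK : 0 < 1 - w by exact: w1.
  have h1 : (1 - w)^-1 <= expR (o%:R * r ^+ 2 / K%:R).
    have -> : (1 - w)^-1 = 1 + w / (1 - w) by field; rewrite gt_eqF.
    apply: le_trans (expR_ge1Dx _) _; rewrite ler_expR.
    have -> : o%:R * r ^+ 2 / K%:R = w / (1 - a ^+ 2 * K%:R).
      by rewrite aK1 /w a2; field; rewrite !gt_eqF.
    rewrite ler_wpM2l// lef_pV2 ?posrE //; last by rewrite subr_gt0.
    rewrite lerD2l lerN2.
    by rewrite ler_wpM2l ?sqr_ge0// ler_nat.
  apply: le_trans (lerXn2r n _ _ h1) _; rewrite ?nnegrE ?expR_ge0 ?invr_ge0 ?(ltW wK)//.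
  rewrite -expRM_natl ler_expR mulrA ler_pdivrMr//.
  have := ler_wpM2r (ler0n R o) nK; lra.
- have -> : - 4^-1 * (- 4 * ln (e ^+ 2 / 4 / X)) = ln (e ^+ 2 / 4 / X) :> R by field.
  rewrite lnK ?posrE// mulrCA -/E -/X le_eqVlt; apply/orP; left; apply/eqP.
  by rewrite divfK// gt_eqF.
- by rewrite (_ : 2 * beta - 1 - c = c)// /c; field.
Qed.

Lemma sqrt_inv_pow_le (n : nat) (y D : R) : expR (- y) <= D ->
  (Num.sqrt D)^-1 ^+ n <= expR (y * n%:R / 2).
Proof.
move=> yD; have D0 : 0 < D by exact: lt_le_trans (expR_gt0 _) yD.
have h : (Num.sqrt D)^-1 <= expR (y / 2).
  rewrite -[expR _]invrK -expRN lef_pV2 ?posrE ?sqrtr_gt0 ?expR_gt0//.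
  rewrite -(@ler_pXn2r _ 2) ?nnegrE ?sqrtr_ge0 ?expR_ge0// sqr_sqrtr ?(ltW D0)//.
  by rewrite -expRM_natl mulrN mulrC divfK.
apply: le_trans (lerXn2r n _ _ h) _; rewrite ?nnegrE ?expR_ge0 ?invr_ge0 ?sqrtr_ge0//.
by rewrite -expRM_natl le_eqVlt; apply/orP; left; apply/eqP; congr expR; ring.
Qed.

(** * Part (1): exponents of order sqrt (ln p / n) *)

Section sparse_regime.
Variables (x1 l0 t0 delta kappa1 kappa2 : R).
(** With z = sqrt (ln p / n) and a = x1 z, l = l0 z, m = m0 z, the determinants of the two row
    integrals are functions of u = z^2 o and u = z^2; their slopes at 0 are - d1 and - d2. *)
Let D (u : R) := (1 - x1 ^+ 2 * u) ^+ 2 + 4 * x1 * l0 * u * (1 - x1 ^+ 2 * u)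
  - l0 ^+ 2 * u * (1 - x1 ^+ 2 * u) ^+ 2.
(** The Chernoff exponent minimizing - m t0 + m x1 + m^2 / 2, with value - (t0 - x1)^2 / 2. *)
Let m0 := t0 - x1.
Let E (u : R) := 1 - 2 * m0 * x1 * u - m0 ^+ 2 * u * (1 - x1 ^+ 2 * u).
Let d1 := 2 * x1 ^+ 2 - 4 * x1 * l0 + l0 ^+ 2.
Let d2 := 2 * m0 * x1 + m0 ^+ 2.

Hypotheses (x1_gt0 : 0 < x1) (l0_ge0 : 0 <= l0) (m0_gt0 : 0 < m0).
Hypothesis D_ge : forall u, 0 <= u <= kappa1 -> expR (- ((d1 + delta) * u)) <= D u.
Hypothesis E_ge : forall u, 0 <= u <= kappa2 -> expR (- ((d2 + delta) * u)) <= E u.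

(** At level T = t0 z n every exponent is a multiple of ln p: a common coordinate weighs at most
    p^c, and the truncation loss is at most p^(1 - beta - m0^2 / 2 + delta / 2). [v] bounds z^2 o
    for all o <= K. *)
Lemma gamma_un_lb_sparse (n p : nat) (r e : R) :
  let L := ln p%:R in
  let v := sparsity beta p * L / n%:R in
  let c := d1 / 2 + l0 * t0 + delta / 2 in
  (0 < p)%N -> (0 < n)%N -> 0 < e ->
  v <= kappa1 -> v <= kappa2 -> x1 ^+ 2 * v < 1 ->
  r <= x1 * Num.sqrt (L / n%:R) * Num.sqrt (Num.truncn (sparsity beta p))%:R ->
  expR (- ((m0 ^+ 2 / 2 - (1 - beta) - delta / 2) * L)) <= e ^+ 2 / 4 ->
  2 * expR (- ((2 * beta - 1 - c) * L)) <= ln (1 + e ^+ 2 / 2) ->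
  ((1 - e)%:E <= gamma_un n p (sparsity beta p) r)%E.
Proof.
move=> L v c p0 n0 e0 vk1 vk2 xv rx etae qe.
set K := Num.truncn (sparsity beta p) in rx.
have [[K0 b0 Kb] [Kk kK _]] := prior_sizes p0; rewrite -/K in K0 Kk kK Kb.
have L0 : 0 <= L by rewrite ln_ge0// ler1n.
have nR : 0 < n%:R :> R by rewrite ltr0n.
have k1 := sparsity_ge1 p0.
pose w := L / n%:R.
have w0 : 0 <= w by rewrite divr_ge0// ltW.
have wn : w * n%:R = L by rewrite /w divfK// gt_eqF.
pose z := Num.sqrt w.
have z0 : 0 <= z by exact: sqrtr_ge0.
have z2 : z ^+ 2 = w by rewrite sqr_sqrtr.
have vE : v = sparsity beta p * w by rewrite /v /w mulrA.
have wv : w <= v by rewrite vE ler_peMl.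
have wKv o : (o <= K)%N -> 0 <= w * o%:R <= v.
  move=> oK; rewrite mulr_ge0//= vE mulrC ler_wpM2r//.
  by apply: le_trans Kk; rewrite ler_nat.
have aKE o : (x1 * z) ^+ 2 * o = x1 ^+ 2 * (w * o) by rewrite exprMn z2 mulrA.
have DE (o : R) : (1 - (x1 * z) ^+ 2 * o) ^+ 2 + 4 * (x1 * z) * (l0 * z) * o *
    (1 - (x1 * z) ^+ 2 * o) -
    (l0 * z) ^+ 2 * o * (1 - (x1 * z) ^+ 2 * o) ^+ 2 = D (w * o).
  by rewrite aKE /D exprMn z2 -z2; ring.
have EE : 1 - 2 * (m0 * z) * (x1 * z) - (m0 * z) ^+ 2 * (1 - (x1 * z) ^+ 2) = E w.
  by rewrite /E -z2; ring.
have Dw o : (o <= K)%N -> expR (- ((d1 + delta) * (w * o%:R))) <= D (w * o%:R).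
  by move=> /wKv /andP[? ?]; apply: D_ge; apply/andP; split=> //; exact: le_trans vk1.
have Ew : expR (- ((d2 + delta) * w)) <= E w.
  by apply: E_ge; rewrite w0/=; exact: le_trans vk2.
have xK : x1 ^+ 2 * (w * K%:R) < 1.
  apply: le_lt_trans xv; rewrite ler_wpM2l ?sqr_ge0//.
  by have /andP[] := wKv K (leqnn K).
have s01 : 0 < Num.sqrt (1 - x1 ^+ 2 * (w * K%:R)) <= 1.
  rewrite sqrtr_gt0 subr_gt0 xK/= -[leRHS]sqrtr1 ler_wsqrtr//.
  by rewrite gerBl mulr_ge0 ?sqr_ge0// mulr_ge0.
apply: (@gamma_un_lb_sparsity n p r (x1 * z) (l0 * z) (m0 * z) (t0 * z * n%:R) c e) => //.
- by rewrite mulr_ge0// ltW.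
- by rewrite aKE.
(* Dividing by the noise level, which is at most 1, can only increase the radius. *)
- rewrite aKE; apply: (le_trans rx); case/andP: s01 => s0 s1.
  rewrite ler_pdivlMr// ler_piMr// mulr_ge0 ?sqrtr_ge0// mulr_ge0 ?sqrtr_ge0// ltW//.
- by rewrite mulr_ge0.
- by rewrite mulr_ge0// ltW.
- by move=> o /Dw h; rewrite DE; exact: lt_le_trans (expR_gt0 _) h.
- move=> o oK; rewrite DE.
  apply: le_trans (ler_wpM2l (expR_ge0 _) (sqrt_inv_pow_le n (Dw o oK))) _.
  rewrite -expRD ler_expR -/L -wn /c -z2 le_eqVlt; apply/orP; left; apply/eqP.
  by field.
- by rewrite EE; exact: lt_le_trans (expR_gt0 _) Ew.
- rewrite EE.
  apply: (@le_trans _ _ (sparsity beta p * (expR (- (m0 * z) * (t0 * z * n%:R)) *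
     expR ((d2 + delta) * w * n%:R / 2)))).
    apply: ler_pM => //.
    by rewrite ler_wpM2l ?expR_ge0//; exact: sqrt_inv_pow_le.
  apply: le_trans etae; rewrite sparsity_exp// -!expRD ler_expR -/L.
  rewrite le_eqVlt; apply/orP; left; apply/eqP.
  by rewrite -wn -z2 /d2 /m0; field.
Qed.

End sparse_regime.

End boundary.

(** * Passage to the limit *)

Section limits.
Variable R : realType.

Lemma limn_esup_lt0 (u : nat -> R) : (limn_esup (fun m => (u m)%:E) < 0)%E ->
  exists2 d : R, 0 < d & \forall m \near \oo, u m <= - d.
Proof.
move=> u0.
have [d d0 ud] : exists2 d : R, 0 < d & (limn_esup (fun m => (u m)%:E) < (- d)%:E)%E.
  move: u0; case: (limn_esup _) => [l| |]// l0.
    by exists (- l / 2); move: l0; rewrite !lte_fin => l0; lra.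
  (* Limit superior - oo: any positive [d] serves. *)
  by exists 1 => //; rewrite ltNye.
exists d => //.
have [_ [V V_oo <-] Vd] := ereal_inf_lt ud.
apply: filterS V_oo => m Vm; rewrite -lee_fin; apply: le_trans (ltW Vd).
by apply: ereal_sup_ubound; exists m.
Qed.

Lemma near_ge_ln (p : nat -> nat) (A : R) : p @ \oo --> \oo ->
  \forall m \near \oo, A <= ln (p m)%:R.
Proof.
move=> /cvgnyPge/(_ (Num.truncn (expR A)).+1); apply: filterS => m pm.
have h : expR A < (p m)%:R.
  apply: lt_le_trans (_ : (Num.truncn (expR A)).+1%:R <= _); last by rewrite ler_nat.
  by have /andP[] := truncn_itv (expR_ge0 A).
rewrite -[A]expRK ler_ln ?posrE ?expR_gt0//; first exact: ltW.
exact: lt_trans (expR_gt0 A) h.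
Qed.

Lemma near_expR_decay (p : nat -> nat) (g X : R) : p @ \oo --> \oo -> 0 < g -> 0 < X ->
  \forall m \near \oo, expR (- (g * ln (p m)%:R)) <= X.
Proof.
move=> pinf g0 X0; apply: filterS (near_ge_ln (- ln X / g) pinf) => m h.
rewrite -[X]lnK ?posrE// ler_expR lerNl mulrC -ler_pdivrMr//.
Qed.

End limits.

Unset Implicit Arguments.

Theorem theorem4p5 (R : realType) (beta : R) (n p : nat -> nat)
    (beta_gt : 1 / 2 < beta) (beta_lt : beta < 1)
    (n_infty : n @ \oo --> \oo) (p_infty : p @ \oo --> \oo) :
  (forall x : nat -> nat -> R,
     sparsity beta (p m) * ln (p m)%:R / (n m)%:R @[m --> \oo] --> (0 : R) ->
     (limn_esup (fun m => (x (n m) (p m) - phi beta)%:E) < 0)%E ->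
     gamma_un (n m) (p m) (sparsity beta (p m))
       (x (n m) (p m) *
        Num.sqrt (sparsity beta (p m) * ln (p m)%:R / (n m)%:R))
       @[m --> \oo] --> (1 : \bar R)%E)
  /\
  (sparsity beta (p m) * ln (p m)%:R / (n m)%:R @[m --> \oo] --> +oo ->
   forall r : R, 0 < r ->
     gamma_un (n m) (p m) (sparsity beta (p m)) r
       @[m --> \oo] --> (1 : \bar R)%E).
Proof.
have p_gt0 : \forall m \near \oo, (0 < p m)%N by move/cvgnyPgt: p_infty; apply.
have n_gt0 : \forall m \near \oo, (0 < n m)%N by move/cvgnyPgt: n_infty; apply.
have lne_gt0 (e : R) : 0 < e -> 0 < ln (1 + e ^+ 2 / 2) / 2.
  by move=> e0; rewrite divr_gt0// ln_gt0// ltrDl divr_gt0// exprn_gt0.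
split=> [x kLn xphi|kLn r r0].
- have [d d0 xd] := limn_esup_lt0 xphi.
  have phid : phi beta - d < phi beta by rewrite ltrBlDr ltrDl.
  have [x1 [l0 [t0 [[x01 x10 l00 x1t0] [gap1 gap2]]]]] :=
    detection_parameters beta_gt beta_lt phid.
  pose m0 := t0 - x1.
  have m00 : 0 < m0 by rewrite subr_gt0.
  pose d1 := 2 * x1 ^+ 2 - 4 * x1 * l0 + l0 ^+ 2.
  pose d2 := 2 * m0 * x1 + m0 ^+ 2.
  (* The smaller of the two gaps; the bounds spend only delta / 2, so both decay rates stay
     positive. *)
  pose delta := Num.min (2 * beta - 1 - (d1 / 2 + l0 * t0)) (m0 ^+ 2 / 2 - (1 - beta)).
  have delta0 : 0 < delta.
    by rewrite lt_min; apply/andP; split; rewrite subr_gt0// /d1; lra.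
  have deltal1 : delta <= 2 * beta - 1 - (d1 / 2 + l0 * t0) by rewrite ge_min lexx.
  have deltal2 : delta <= m0 ^+ 2 / 2 - (1 - beta) by rewrite ge_min lexx orbT.
  have [k1 k10 D_ge] : exists2 kappa, 0 < kappa & forall u, 0 <= u <= kappa ->
      expR (- ((d1 + delta) * u)) <= (1 - x1 ^+ 2 * u) ^+ 2 +
        4 * x1 * l0 * u * (1 - x1 ^+ 2 * u) - l0 ^+ 2 * u * (1 - x1 ^+ 2 * u) ^+ 2.
    (* The constant collects the negative terms beyond first order, the cubic one being bounded
       through u <= 1. *)
    apply: (@expR_le_near0 _ _ _ (4 * x1 ^+ 3 * l0 + l0 ^+ 2 * x1 ^+ 4)) => //.
      by rewrite addr_ge0 ?mulr_ge0 ?exprn_ge0// ltW.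
    move=> u /andP[u0 u1].
    have h : 0 <= l0 ^+ 2 * x1 ^+ 4 * u ^+ 2 * (1 - u).
      by rewrite !mulr_ge0 ?exprn_ge0 ?subr_ge0// ltW.
    have h' : 0 <= (x1 ^+ 4 + 2 * l0 ^+ 2 * x1 ^+ 2) * u ^+ 2.
      by rewrite mulr_ge0 ?addr_ge0 ?mulr_ge0 ?exprn_ge0// ltW.
    rewrite -subr_ge0 (_ : _ - _ = l0 ^+ 2 * x1 ^+ 4 * u ^+ 2 * (1 - u) +
      (x1 ^+ 4 + 2 * l0 ^+ 2 * x1 ^+ 2) * u ^+ 2); first by rewrite addr_ge0.
    by rewrite /d1; ring.
  have [k2 k20 E_ge] : exists2 kappa, 0 < kappa & forall u, 0 <= u <= kappa ->
      expR (- ((d2 + delta) * u)) <=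
        1 - 2 * m0 * x1 * u - m0 ^+ 2 * u * (1 - x1 ^+ 2 * u).
    apply: (@expR_le_near0 _ _ _ 0) => // u /andP[u0 _].
    rewrite -subr_ge0 (_ : _ - _ = m0 ^+ 2 * x1 ^+ 2 * u ^+ 2); last by rewrite /d2; ring.
    by rewrite !mulr_ge0 ?exprn_ge0// ltW.
  pose y0 := Num.max (phi beta - d) 0.
  have y00 : 0 <= y0 by rewrite le_max lexx orbT.
  have y0x1 : y0 < x1 by rewrite gt_max x01.
  have y2 : 0 < x1 ^+ 2 - y0 ^+ 2 by rewrite subr_gt0 ltr_pXn2r ?nnegrE// ltW.
  have k30 : 0 < (2 * x1 ^+ 2)^-1 by rewrite invr_gt0 mulr_gt0// exprn_gt0.
  have v1 (k : R) : 0 < k -> \forall m \near \oo,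
      sparsity beta (p m) * ln (p m)%:R / (n m)%:R <= k.
    by move=> k0; move/cvgr_le: kLn; apply.
  apply: gamma_un_cvg1 => e e0; near=> m.
  have pm : (0 < p m)%N by near: m.
  have nm : (0 < n m)%N by near: m.
  apply: (gamma_un_lb_sparse beta_gt beta_lt x10 l00 m00 D_ge E_ge) => //.
  + by near: m; exact: v1.
  + by near: m; exact: v1.
  + have : sparsity beta (p m) * ln (p m)%:R / (n m)%:R <= (2 * x1 ^+ 2)^-1.
      by near: m; exact: v1.
    move=> /(ler_wpM2l (ltW (exprn_gt0 2 x10)))/le_lt_trans; apply.
    by rewrite invfM mulrCA mulfV ?gt_eqF ?exprn_gt0//; lra.
  + have xm : x (n m) (p m) <= y0.
      have : x (n m) (p m) - phi beta <= - d by near: m.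
      by rewrite le_max; move=> ?; apply/orP; left; lra.
    have [_ [Kk kK _]] := prior_sizes beta_gt beta_lt pm.
    have k0 : 0 <= sparsity beta (p m) by apply: (le_trans ler01); exact: sparsity_ge1.
    (* The gap between y0 and x1 pays for rounding: y0^2 k <= x1^2 K follows from K > k - 1 once
       (x1^2 - y0^2) k >= x1^2. *)
    have kA : x1 ^+ 2 / (x1 ^+ 2 - y0 ^+ 2) <= sparsity beta (p m).
      have : expR (- ((1 - beta) * ln (p m)%:R)) <= (x1 ^+ 2 / (x1 ^+ 2 - y0 ^+ 2))^-1.
        near: m; apply: near_expR_decay => //; first by rewrite subr_gt0.
        by rewrite invr_gt0 divr_gt0// exprn_gt0.
      rewrite expRN -sparsity_exp// lef_pV2 ?posrE ?divr_gt0 ?exprn_gt0//.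
      by rewrite sparsity_exp ?expR_gt0.
    rewrite -[X in Num.sqrt X]mulrA sqrtrM// mulrA [leRHS]mulrAC.
    apply: ler_wpM2r; first exact: sqrtr_ge0.
    apply: (@le_trans _ _ (y0 * Num.sqrt (sparsity beta (p m)))).
      by rewrite ler_wpM2r ?sqrtr_ge0.
    rewrite -(@ler_pXn2r _ 2) ?nnegrE ?mulr_ge0 ?sqrtr_ge0 ?(ltW x10)//.
    rewrite !exprMn !sqr_sqrtr//.
    move: kA; rewrite ler_pdivrMr// => kA.
    have : x1 ^+ 2 * sparsity beta (p m) <=
        x1 ^+ 2 * ((Num.truncn (sparsity beta (p m)))%:R + 1).
      by rewrite ler_wpM2l ?exprn_ge0 ?ltW.
    lra.
  + near: m; apply: near_expR_decay => //; last by rewrite divr_gt0// exprn_gt0.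
    by rewrite -/m0; lra.
  + rewrite mulrC -ler_pdivlMr//; near: m; apply: near_expR_decay => //.
      by rewrite -/d1; lra.
    exact: lne_gt0.
- have c0 : 0 < (2 * beta - 1) / 2 by lra.
  apply: gamma_un_cvg1 => e e0; near=> m.
  have pm : (0 < p m)%N by near: m.
  have nm : (0 < n m)%N by near: m.
  apply: gamma_un_lb_dense => //.
  + have nR : 0 < (n m)%:R :> R by rewrite ltr0n.
    have : 2 * r ^+ 2 / ((2 * beta - 1) / 2) <=
        sparsity beta (p m) * ln (p m)%:R / (n m)%:R.
      by near: m; move/cvgryPge: kLn; apply.
    by rewrite ler_pdivlMr// mulrAC ler_pdivrMr// [leRHS]mulrC.
  + rewrite mulrC -ler_pdivlMr//; near: m; apply: near_expR_decay => //; exact: lne_gt0.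
Unshelve. all: by end_near. Qed.
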